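(* Let $q\in\mathbb{N}_0$. Then for each $n\in\mathbb{N}$ there exists a positive linear operator $M_n: C[0,1]\to\Pi_n$ preserving $k$-monotonicity for every $0\le k\le q$ (i.e. $f\in\Delta^{(k)}$ implies $M_n(f,\cdot)\in\Delta^{(k)}$) and such that, for any $0\le\lambda<2$, $f\in C[0,1]$ and $x\in[0,1]$, one has $$|f(x)-M_n(f,x)|\le c\,\omega_2^{\varphi^\lambda}\!\left(f,\;n^{-1}\varphi^{1-\lambda/2}(x)\left(\varphi(x)+1/n\right)^{-\lambda/2}\right),$$ where $c$ is a constant that depends only on $q$ and on $\lambda$ as $\lambda\to2-$ (that is, $c$ does not depend on $n,f,x$, and for each $\lambda_1<2$ it can be chosen uniformly for $\lambda\in[0,\lambda_1]$). In particular, for $\lambda=0$ and $\lambda=1$ we have, respectively, $$|f(x)-M_n(f,x)|\le c\,\omega_2\!\left(f,\frac{\sqrt{x(1-x)}}{n}\right)$$ and $$|f(x)-M_n(f,x)|\le c\,\omega_2^{\varphi}\!\left(f,\;n^{-1}\sqrt{\frac{\varphi(x)}{\varphi(x)+1/n}}\right)\le c\,\omega_2^{\varphi}\left(f,n^{-1}\right).$$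
   Context: $\mathbb{N}=\{1,2,\dots\}$, $\mathbb{N}_0=\mathbb{N}\cup\{0\}$; $\Pi_n$ is the space of real algebraic polynomials of degree $\le n$; $\|\cdot\|$ is the sup norm on $[0,1]$; $\varphi(x):=\sqrt{x(1-x)}$. The $k$th symmetric difference of $f$ with step $\delta$ is $\Delta_\delta^k(f,x):=\sum_{i=0}^k\binom{k}{i}(-1)^{k-i}f(x-k\delta/2+i\delta)$, with $\Delta_\delta^k(f,x):=0$ if $x-k\delta/2\notin[0,1]$ or $x+k\delta/2\notin[0,1]$. A function $f\in C[0,1]$ is $k$-monotone if $\Delta_\delta^k(f,x)\ge0$ for all $\delta>0$ and all $x\in[0,1]$; $\Delta^{(k)}$ is the set of all $k$-monotone functions in $C[0,1]$ (so $\Delta^{(0)},\Delta^{(1)},\Delta^{(2)}$ are the nonnegative, nondecreasing and convex functions, respectively). For a function $\psi\ge0$ on $[0,1]$, $\omega_2^\psi(f,t):=\sup_{0<h\le t}\|\Delta^2_{h\psi(\cdot)}(f,\cdot)\|$ for $t>0$ is the second Ditzian–Totik modulus, $\omega_2(f,t):=\omega_2^{\psi}(f,t)$ with $\psi\equiv1$ is the classical second modulus, and the moduli at $t=0$ are understood to be $0$. Here $\varphi^\lambda(x)=(\varphi(x))^\lambda$. A linear operator $L$ on $C[0,1]$, whose value at $f$ is the function $x\mapsto L(f,x)$, is positive if $L(f,x)\ge0$ on $[0,1]$ whenever $f\ge0$ on $[0,1]$. *)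

(* Defs.v *)
From mathcomp Require Import all_boot all_order all_algebra.
From mathcomp Require Import all_classical all_reals all_analysis.
Set Implicit Arguments.
Unset Strict Implicit.
Unset Printing Implicit Defensive.
Import Order.TTheory GRing.Theory Num.Theory.
Import numFieldNormedType.Exports.
Local Open Scope classical_set_scope.
Local Open Scope ring_scope.

(* An element of C[0,1] is represented by a function R -> R that is continuous
   on the subspace [0,1]; its values outside [0,1] are irrelevant, and every
   notion below only looks at f on [0,1]. *)
Definition C01 (R : realType) (f : R -> R) : Prop :=
  {within `[0, 1]%classic, continuous f}.

Definition sup_norm (R : realType) (g : R -> R) : R :=
  sup [set `|g x| | x in `[0, 1]%classic].

Definition phi (R : realType) (x : R) : R := Num.sqrt (x * (1 - x)).

Definition sym_diff (R : realType) (k : nat) (delta : R) (f : R -> R) (x : R)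
    : R :=
  if (0 <= x - k%:R * delta / 2 <= 1) && (0 <= x + k%:R * delta / 2 <= 1) then
    \sum_(i < k.+1) 'C(k, i)%:R * (-1) ^+ (k - i) *
                    f (x - k%:R * delta / 2 + i%:R * delta)
  else 0.

Definition kmonotone (R : realType) (k : nat) (f : R -> R) : Prop :=
  C01 f /\
  forall delta x : R, 0 < delta -> 0 <= x <= 1 -> 0 <= sym_diff k delta f x.

(* The suprema are finite, since f is bounded on [0,1]. For t = 0 the index set
   is empty and sup set0 = 0, so the modulus at t = 0 is 0. *)
Definition omega2_w (R : realType) (psi f : R -> R) (t : R) : R :=
  sup [set sup_norm (fun x => sym_diff 2 (h * psi x) f x)
      | h in `]0, t]%classic].

Definition omega2 (R : realType) (f : R -> R) (t : R) : R :=
  omega2_w (fun=> 1) f t.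

(* The first clause says that L is well defined on C[0,1], i.e. that it does not
   depend on the values of the representative f outside [0,1]. *)
Definition linear_operator (R : realType) (L : (R -> R) -> {poly R}) : Prop :=
  (forall f g : R -> R, C01 f -> C01 g ->
     (forall x, 0 <= x <= 1 -> f x = g x) -> L f = L g) /\
  (forall (a : R) (f g : R -> R), C01 f -> C01 g ->
     L (fun x => a * f x + g x) = a *: L f + L g).

Definition positive_operator (R : realType) (L : (R -> R) -> {poly R}) : Prop :=
  forall f : R -> R, C01 f -> (forall x, 0 <= x <= 1 -> 0 <= f x) ->
  forall x, 0 <= x <= 1 -> 0 <= (L f).[x].

(* Pi_n; size p is the degree of p plus one *)
Definition into_Pi (R : realType) (n : nat) (L : (R -> R) -> {poly R}) : Prop :=
  forall f : R -> R, C01 f -> (size (L f) <= n.+1)%N.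

Definition preserves_kmonotonicity (R : realType) (k : nat)
    (L : (R -> R) -> {poly R}) : Prop :=
  forall f : R -> R, kmonotone k f -> kmonotone k (horner (L f)).

(* Main.v *)
(* M_n f = V_H (B f), where B is the Bernstein operator of degree n^2 and V_H is
   the mixture sum_N H_N U_N of genuine Bernstein-Durrmeyer operators, H_N being
   the coefficients of a polynomial H of degree <= n.  Since B preserves
   positivity and k-monotonicity, V_H only has to be studied on polynomials.

   For r >= 1, (V_H f)^(r)(x) is the integral over u in [0, 1] of f^(r)(u) times
   (u(1-u))^(r-1)/(r-1)! times a mean of H^(r) over the points
   xu + (1-x)(1-u) + 2 sqrt(xu(1-x)(1-u)) t of [0, 1], with the Gegenbauer weight
   (1-t^2)^(r-3/2); the kernel of V_H itself is x(1-x) times such a mean of H'',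
   besides point masses H(1-x) at 0 and H(x) at 1.  Hence V_H is positive and preserves k-monotonicity for
   k <= q as soon as H and its derivatives up to order q + 2 are nonnegative on
   [0, 1].  When H(0) = 0 and H(1) = 1, V_H reproduces affine functions and its
   second moment at x is 2x(1-x) times the integral of H, which is O(n^-2) when H
   is a (q+2)-fold antiderivative of a Jackson-type power of a Dirichlet kernel.

   For the estimate, fix x and w > omega_2^(phi^l)(f, t).  An explicit convex
   function Psi has second differences larger than w at the steps t phi(z)^l, so
   by a discrete maximum principle f + Psi and - f + Psi are convex up to the
   error w.  Jensen's inequality then bounds |f(x) - M_n(f, x)| by w plus the
   increment M_n(Psi, x) - Psi(x), which the second moment controls. *)

From HB Require Import structures.
Require Import Defs.
From mathcomp Require Import all_boot all_order all_algebra.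
From mathcomp Require Import all_classical all_reals all_analysis.
From mathcomp Require Import ring lra zify.
Import Order.TTheory GRing.Theory Num.Theory.
Import numFieldNormedType.Exports.
Set Implicit Arguments.
Unset Strict Implicit.
Unset Printing Implicit Defensive.
Local Open Scope classical_set_scope.
Local Open Scope ring_scope.

(** * Integration of polynomials *)

Section PolynomialIntegral.
Variable R : realType.
Implicit Types p q : {poly R}.

Lemma le_of_derive_ge0 (f df : R -> R) (a b : R) : a <= b ->
  (forall x : R, a <= x <= b -> is_derive x 1 f (df x)) ->
  (forall x : R, a <= x <= b -> 0 <= df x) -> f a <= f b.
Proof.
move=> ab dfE df0; rewrite -subr_ge0.
have [||c] := @MVT_segment _ f df a b ab.
- by move=> x; rewrite in_itv/= => /andP[/ltW ax /ltW xb]; apply: dfE; rewrite ax.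
- apply: derivable_within_continuous => x; rewrite in_itv/= => xab.
  exact: (@ex_derive _ _ _ _ _ _ _ (dfE x xab)).
rewrite in_itv/= => cab ->; apply: mulr_ge0; first exact: df0.
by rewrite subr_ge0.
Qed.

Lemma horner_le (p : {poly R}) (a b : R) : a <= b ->
  (forall x, a <= x <= b -> 0 <= p^`().[x]) -> p.[a] <= p.[b].
Proof.
move=> ab p0; apply: (@le_of_derive_ge0 _ (fun x => p^`().[x]) a b) => // x _.
Qed.

(** At [i = 0] the quotient by [0%:R] is 0, which makes 0 the constant of integration. *)
Definition antideriv p : {poly R} :=
  \poly_(i < (size p).+1) (p`_i.-1 / i%:R).

Lemma coef_antideriv p i : (antideriv p)`_i = p`_i.-1 / i%:R.
Proof.
rewrite coef_poly; case: ltnP => // hi.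
by rewrite nth_default ?mul0r//; case: i hi => // i; rewrite ltnS.
Qed.

Lemma antideriv_is_linear : linear antideriv.
Proof.
by move=> a p q; apply/polyP => i; rewrite !(coefD, coefZ, coef_antideriv)/= mulrDl mulrA.
Qed.
HB.instance Definition _ := GRing.isLinear.Build R {poly R} {poly R} _
  antideriv antideriv_is_linear.

Lemma deriv_antideriv p : (antideriv p)^`() = p.
Proof.
apply/polyP => i; by rewrite coef_deriv coef_antideriv -[LHS]mulr_natr divfK.
Qed.

Lemma antideriv_at0 p : (antideriv p).[0] = 0.
Proof. by rewrite horner_coef0 coef_antideriv invr0 mulr0. Qed.

Lemma size_antideriv p : (size (antideriv p) <= (size p).+1)%N.
Proof. exact: size_poly. Qed.

Lemma antideriv_ge0 p : (forall x, 0 <= x <= 1 -> 0 <= p.[x]) ->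
  forall x, 0 <= x <= 1 -> 0 <= (antideriv p).[x].
Proof.
move=> p0 x /andP[x0 x1]; rewrite -(antideriv_at0 p); apply: horner_le => // y.
by rewrite deriv_antideriv => /andP[y0 yx]; apply: p0; rewrite y0 (le_trans yx).
Qed.

(** Only polynomials are ever integrated, so the integral over [0, 1] can be purely algebraic. *)
Definition int01 p : R := (antideriv p).[1].

Lemma int01_is_linear : linear (int01 : {poly R} -> R^o).
Proof. by move=> a p q; rewrite /int01 linearP/= hornerD hornerZ. Qed.
HB.instance Definition _ := GRing.isLinear.Build R {poly R} R^o _
  (int01 : {poly R} -> R^o) int01_is_linear.

Lemma int01D p q : int01 (p + q) = int01 p + int01 q.
Proof. exact: (raddfD (int01 : {poly R} -> R^o)). Qed.

Lemma int01B p q : int01 (p - q) = int01 p - int01 q.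
Proof. exact: (raddfB (int01 : {poly R} -> R^o)). Qed.

Lemma int01Z a p : int01 (a *: p) = a * int01 p.
Proof. by rewrite /int01 linearZ hornerZ. Qed.

Lemma int01Zl a p q : int01 (a *: p * q) = a * int01 (p * q).
Proof. by rewrite -scalerAl int01Z. Qed.

Lemma int01_sum (I : Type) (r : seq I) (P : pred I) (F : I -> {poly R}) :
  int01 (\sum_(i <- r | P i) F i) = \sum_(i <- r | P i) int01 (F i).
Proof. exact: (raddf_sum (int01 : {poly R} -> R^o)). Qed.

Lemma int01_ge0 p : (forall x, 0 <= x <= 1 -> 0 <= p.[x]) -> 0 <= int01 p.
Proof. by move=> p0; apply: antideriv_ge0; rewrite // ler01 lexx. Qed.

Lemma int01_deriv p : int01 p^`() = p.[1] - p.[0].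
Proof.
have h i : (antideriv p^`() - p)`_i.+1 = 0.
  by rewrite coefB coef_antideriv coef_deriv /= -[X in X / _]mulr_natr mulfK ?subrr.
have E : antideriv p^`() - p = (- p.[0])%:P.
  apply/polyP => -[|i]; last by rewrite h coefC.
  by rewrite coefB coefC/= coef_antideriv invr0 mulr0 sub0r horner_coef0.
rewrite /int01 -[antideriv _](subrK p) E hornerD hornerC.
by rewrite addrC.
Qed.

Lemma int01_by_parts p q :
  int01 (p^`() * q) = p.[1] * q.[1] - p.[0] * q.[0] - int01 (p * q^`()).
Proof. by rewrite -!hornerM -int01_deriv derivM int01D addrK. Qed.

End PolynomialIntegral.

(** * Bernstein polynomials *)

(* Locked because rewriting with [hornerZ] or [scalerAl] would otherwise unfold it. *)
HB.lock Definition bern (R : realType) (n k : nat) : {poly R} :=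
  'C(n, k)%:R *: ('X^k * (1 - 'X) ^+ (n - k)).

Section Bernstein.
Variable R : realType.
Implicit Types (p q : {poly R}) (c : nat -> R).

Local Notation bern := (bern R).

Lemma bern_small n k : (n < k)%N -> bern n k = 0.
Proof. by move=> nk; rewrite !bern.unlock bin_small// scale0r. Qed.

Lemma horner_bern n k x : (bern n k).[x] = 'C(n, k)%:R * (x ^+ k * (1 - x) ^+ (n - k)).
Proof. by rewrite !bern.unlock !hornerE. Qed.

Lemma bern_ge0 n k x : 0 <= x <= 1 -> 0 <= (bern n k).[x].
Proof.
move=> /andP[x0 x1]; rewrite horner_bern mulr_ge0 ?ler0n// mulr_ge0 ?exprn_ge0//.
by rewrite subr_ge0.
Qed.

Lemma bern_at0 n k : (bern n k).[0] = (k == 0%N)%:R.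
Proof.
rewrite horner_bern subr0 expr1n mulr1 expr0n.
by case: k => [|k]; rewrite ?bin0 ?mulr1 ?mulr0.
Qed.

Lemma bern_at1 n k : (bern n k).[1] = (k == n)%:R.
Proof.
rewrite horner_bern subrr expr1n mul1r expr0n.
case: (ltngtP k n) => [kn|nk|->]; last by rewrite binn subnn mulr1.
  by rewrite -(subnSK kn) mulr0.
by rewrite bin_small// mul0r.
Qed.

Lemma sum_bern n : \sum_(k < n.+1) bern n k = 1.
Proof.
have := exprDn (1 - 'X : {poly R}) 'X n.
rewrite subrK expr1n => ->; apply: eq_bigr => i _.
by rewrite !bern.unlock scaler_nat mulrC.
Qed.

Lemma deriv_bern0 n : (bern n.+1 0)^`() = - n.+1%:R *: bern n 0.
Proof.
rewrite !bern.unlock !bin0 !scale1r !expr0 !mul1r !subn0 deriv_exp derivB derivX derivC.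
by rewrite sub0r mulN1r mulNrn scaleNr scaler_nat.
Qed.

Lemma deriv_bernS n k :
  (bern n.+1 k.+1)^`() = n.+1%:R *: (bern n k - bern n k.+1).
Proof.
have dX m : ((1 - 'X : {poly R}) ^+ m)^`() = - m%:R *: (1 - 'X) ^+ m.-1.
  by rewrite deriv_exp derivB derivX derivC sub0r mulN1r mulNrn scaleNr scaler_nat.
rewrite !bern.unlock subSS derivZ derivM derivXn dX /= -(scaler_nat k.+1 'X^k).
have c1 : n.+1%:R * 'C(n, k)%:R = 'C(n.+1, k.+1)%:R * k.+1%:R :> R.
  by rewrite -!natrM mul_bin_diag mulnC.
have c2 : n.+1%:R * 'C(n, k.+1)%:R = 'C(n.+1, k.+1)%:R * (n - k)%:R :> R.
  by rewrite -!natrM (mul_bin_down n.+1) subSS mulnC.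
rewrite scalerBr !scalerA c1 c2 subnS.
rewrite scalerDr -scalerAr -scalerAl !scalerA; congr (_ + _).
by rewrite mulrN scaleNr.
Qed.

(** [deriv_bernS] equates consecutive integrals, because [bern n.+1 j.+1] vanishes at 0 and 1 for j
    < n; the n + 1 equal values sum to 1. *)
Lemma int01_bern n k : (k <= n)%N -> int01 (bern n k) = n.+1%:R^-1.
Proof.
have n0 : n.+1%:R != 0 :> R by rewrite pnatr_eq0.
have step j : (j < n)%N -> int01 (bern n j) = int01 (bern n j.+1).
  move=> jn; apply/eqP; rewrite -subr_eq0 -int01B.
  rewrite -(mulrI_eq0 _ (mulfI n0)) -int01Z -deriv_bernS int01_deriv.
  by rewrite bern_at0 bern_at1 eqSS ltn_eqF// subrr.
have all j : (j <= n)%N -> int01 (bern n j) = int01 (bern n 0).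
  by elim: j => // j IH jn; rewrite -step// IH// ltnW.
move=> kn; rewrite all//; apply: (mulfI n0); rewrite divff//.
have := congr1 (@int01 R) (sum_bern n).
rewrite int01_sum (eq_bigr (fun=> int01 (bern n 0))); last first.
  by move=> i _; apply: all; rewrite -ltnS.
rewrite sumr_const card_ord mulr_natl => ->.
by rewrite -[1]derivX int01_deriv !hornerX subr0.
Qed.

Definition diff_seq c : nat -> R := fun j => c j.+1 - c j.

Definition bsum n c : {poly R} := \sum_(j < n.+1) c j *: bern n j.

Lemma eq_bsum n c1 c2 : (forall j, (j <= n)%N -> c1 j = c2 j) ->
  bsum n c1 = bsum n c2.
Proof. by move=> e; apply: eq_bigr => j _; rewrite e// -ltnS. Qed.

Lemma bsumP n a c1 c2 :
  bsum n (fun j => a * c1 j + c2 j) = a *: bsum n c1 + bsum n c2.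
Proof.
rewrite /bsum scaler_sumr -big_split; apply: eq_bigr => j _.
by rewrite scalerDl scalerA.
Qed.

Lemma bsum_const n a : bsum n (fun=> a) = a%:P.
Proof. by rewrite /bsum -scaler_sumr sum_bern alg_polyC. Qed.

Lemma bsum_ge0 n c x : 0 <= x <= 1 -> (forall j, (j <= n)%N -> 0 <= c j) ->
  0 <= (bsum n c).[x].
Proof.
move=> x01 c0; rewrite /bsum horner_sum sumr_ge0// => i _.
by rewrite hornerZ mulr_ge0 ?bern_ge0// c0// -ltnS.
Qed.

Lemma size_bern n k : (size (bern n k) <= n.+1)%N.
Proof.
case: (ltnP n k) => [nk|kn]; first by rewrite bern_small// size_poly0.
rewrite bern.unlock.
apply: (leq_trans (size_scale_leq _ _)); apply: (leq_trans (size_polyMleq _ _)).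
rewrite size_polyXn /= -[X in (_ <= X.+1)%N](subnKC kn) -addnS leq_add2l.
have s1 : (size (1 - 'X : {poly R})).-1 = 1%N.
  by rewrite -opprB size_polyN -(polyC1 R) size_XsubC.
by apply: (leq_trans (size_poly_exp_leq _ _)); rewrite s1 mul1n.
Qed.

Lemma size_bsum n c : (size (bsum n c) <= n.+1)%N.
Proof.
rewrite /bsum; apply: (leq_trans (size_sum _ _ _)); apply/bigmax_leqP => i _.
by apply: (leq_trans (size_scale_leq _ _)); exact: size_bern.
Qed.

Lemma deriv_bsum n c : (bsum n.+1 c)^`() = n.+1%:R *: bsum n (diff_seq c).
Proof.
rewrite /bsum raddf_sum/= big_ord_recl/= derivZ deriv_bern0.
under eq_bigr do rewrite derivZ /= /bump/= add1n deriv_bernS scalerA mulrC -scalerA scalerBr.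
rewrite scaler_sumr /diff_seq.
under [RHS]eq_bigr do rewrite scalerBl.
rewrite -!scaler_sumr !sumrB scalerA mulrC -scalerA scaleNr -scalerN -scalerDr.
congr (_ *: _); rewrite addrCA; congr (_ + _).
rewrite [in LHS]big_ord_recr/= [bern n n.+1]bern_small// scaler0 addr0 [in RHS]big_ord_recl opprD/=.
by congr (_ - _); apply: eq_bigr => i _.
Qed.

Lemma derivn_bsum r m c :
  (bsum (m + r) c)^`(r) = ((m + r) ^_ r)%:R *: bsum m (iter r diff_seq c).
Proof.
elim: r c => [|r IH] c; first by rewrite addn0 ffactn0 scale1r derivn0.
rewrite derivSn addnS deriv_bsum derivnZ IH scalerA -natrM ffactSS.
by rewrite -iterSr.
Qed.

(** The alternating sum is the one of [sym_diff], which links differences of coefficients to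
    k-monotonicity. *)
Lemma iter_diff_seqE r c j : iter r diff_seq c j =
  \sum_(i < r.+1) 'C(r, i)%:R * (-1) ^+ (r - i) * c (j + i)%N.
Proof.
elim: r c j => [|r IH] c j.
  by rewrite big_ord_recl big_ord0 addr0 bin0 expr0 !mul1r addn0.
rewrite iterSr IH [RHS]big_ord_recl.
under eq_bigr do rewrite /diff_seq mulrBr.
rewrite sumrB.
under [in RHS]eq_bigr do rewrite /= /bump/= add1n binS natrD subSS !mulrDl addnS.
rewrite [in RHS]big_split/= addrA [RHS]addrC; congr (_ + _).
rewrite [X in - X]big_ord_recl [in RHS]big_ord_recr/= (@bin_small r r.+1)// !mul0r addr0.
rewrite opprD !bin0 !mul1r !subn0 exprS mulN1r mulNr; congr (_ + _).
rewrite -sumrN; apply: eq_bigr => i _; rewrite /bump/= add1n addnS.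
have -> : (r - i = (r - i.+1).+1)%N by rewrite subnSK.
by rewrite exprS mulN1r mulrN mulNr.
Qed.

Lemma derivn_bsum_ge0 r n c x : 0 <= x <= 1 ->
  (forall j, (j + r <= n)%N -> 0 <= iter r diff_seq c j) ->
  0 <= (bsum n c)^`(r).[x].
Proof.
move=> x01 c0; case: (leqP r n) => [rn|nr]; last first.
  by rewrite derivn_poly0 ?horner0//; apply: leq_trans nr; exact: size_bsum.
rewrite -(subnK rn) derivn_bsum hornerZ mulr_ge0 ?ler0n//.
by apply: bsum_ge0 => // j jm; apply: c0; rewrite -(subnK rn) leq_add2r.
Qed.

Lemma mulX_bern n k : n.+1%:R *: ('X * bern n k) = k.+1%:R *: bern n.+1 k.+1.
Proof.
rewrite !bern.unlock subSS -scalerAr !scalerA -!natrM mul_bin_diag mulrA -exprS.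
by [].
Qed.

(** Starting from a constant sequence, this yields the factorial moments j and j (j - 1) in turn. At
    [j = 0] the value [c 0.-1] is multiplied by 0. *)
Lemma bsum_mulX n c :
  bsum n.+1 (fun j => j%:R * c j.-1) = n.+1%:R *: ('X * bsum n c).
Proof.
rewrite /bsum big_ord_recl mul0r scale0r add0r mulr_sumr scaler_sumr.
apply: eq_bigr => i _; rewrite /= /bump/= add1n.
by rewrite -scalerAr [RHS]scalerA [in RHS]mulrC -[RHS]scalerA mulX_bern scalerA mulrC.
Qed.

Lemma bsum_id n : bsum n (fun j => j%:R) = n%:R *: 'X.
Proof.
case: n => [|n]; first by rewrite /bsum big_ord_recl big_ord0 !scale0r addr0.
rewrite (@eq_bsum _ _ (fun j => j%:R * (fun=> 1) j.-1)); last by move=> *; rewrite mulr1.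
by rewrite (bsum_mulX n (fun=> 1)) bsum_const polyC1 mulr1.
Qed.

Lemma bsum_sq n : bsum n (fun j => j%:R * (j%:R - 1)) =
  (n%:R * (n%:R - 1)) *: 'X^2.
Proof.
case: n => [|n]; first by rewrite /bsum big_ord_recl big_ord0 !mul0r !scale0r addr0.
rewrite (@eq_bsum _ _ (fun j => j%:R * (fun i => i%:R) j.-1)); last first.
  by move=> [|j] _; rewrite ?mul0r//= -natr1 addrK.
by rewrite (bsum_mulX n (fun i => i%:R)) bsum_id -natr1 addrK -scalerAr scalerA expr2.
Qed.

End Bernstein.

(** * The product formula *)

Section ChebyshevFunctional.
Variable R : realType.
Implicit Types g h : {poly R}.

(** The mean of cos^k over [0, pi], by Wallis's recursion; see [cos_antideriv_pi]. *)
Fixpoint cos_moment (k : nat) : R :=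
  match k with
  | 0 => 1
  | 1 => 0
  | (k'.+1 as k1).+1 => k1%:R / k1.+1%:R * cos_moment k'
  end.

(** The antiderivative of cos^k that vanishes at 0, by the usual reduction formula. *)
Fixpoint cos_antideriv (k : nat) (t : R) : R :=
  match k with
  | 0 => t
  | 1 => sin t
  | (k'.+1 as k1).+1 =>
      k1.+1%:R^-1 * (k1%:R * cos_antideriv k' t + cos t ^+ k1 * sin t)
  end.

Lemma cos_momentSS k :
  k.+2%:R * cos_moment k.+2 = k.+1%:R * cos_moment k.
Proof. by rewrite /= mulrA mulrCA divff ?mulr1// pnatr_eq0. Qed.

Lemma cos_antiderivSS k : cos_antideriv k.+2 = fun t =>
  k.+2%:R^-1 * (k.+1%:R * cos_antideriv k t + cos t ^+ k.+1 * sin t).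
Proof. by []. Qed.

Lemma nat_ind2 (P : nat -> Prop) :
  P 0%N -> P 1%N -> (forall k, P k -> P k.+2) -> forall k, P k.
Proof.
move=> P0 P1 PS k; suff: P k /\ P k.+1 by case.
by elim: k => // k [Pk Pk1]; split=> //; exact: PS.
Qed.

Lemma is_derive_cos_antideriv k (t : R) :
  is_derive t 1 (cos_antideriv k) (cos t ^+ k).
Proof.
elim/nat_ind2: k => [||k IH].
- exact: is_derive_id.
- exact: is_derive_sin.
rewrite cos_antiderivSS.
have c0 : k.+2%:R != 0 :> R by rewrite pnatr_eq0.
have d1 : is_derive t 1 ((cos : R -> R) ^+ k.+1 * sin : R -> R)
    (cos t ^+ k.+1 * cos t + sin t * (k.+1%:R * cos t ^+ k * - sin t)).
  apply: is_derive_eq; rewrite /GRing.scale/= exprfctE mulr_natl.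
  by [].
have d2 := is_deriveZ k.+2%:R^-1 (is_deriveD (is_deriveZ k.+1%:R IH) d1).
rewrite (_ : (fun _ => _) = k.+2%:R^-1 \*:
  (k.+1%:R \*: cos_antideriv k + (cos : R -> R) ^+ k.+1 * sin)); last first.
  by apply/funext => u; rewrite /= exprfctE.
apply: (is_derive_eq d2); rewrite [in RHS]exprSr [in RHS]exprSr; set C := cos t ^+ k.+1.
rewrite /GRing.scale/=; apply: (mulfI c0); rewrite !mulrA divff// mul1r.
have -> : sin t * k.+1%:R * cos t ^+ k * - sin t =
  k.+1%:R * cos t ^+ k * (cos t ^+ 2 - 1) by rewrite cos2sin2; ring.
by rewrite /C exprSr -!natr1; ring.
Qed.

Lemma cos_antideriv_at0 k : cos_antideriv k 0 = 0.
Proof.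
elim/nat_ind2: k => [||k IH]//; first exact: sin0.
by rewrite cos_antiderivSS IH sin0 !mulr0 addr0 mulr0.
Qed.

Lemma cos_antideriv_pi k : cos_antideriv k pi = pi * cos_moment k.
Proof.
elim/nat_ind2: k => [||k IH].
- by rewrite /= mulr1.
- by rewrite /= sinpi mulr0.
rewrite cos_antiderivSS IH sinpi mulr0 addr0 /=.
by move: (k.+2%:R^-1 : R) (k.+1%:R : R) => c d; ring.
Qed.

(* The mean value of [g (cos t)] over [0, pi]. *)
Definition cheb_mean g : R := \sum_(i < size g) g`_i * cos_moment i.

Lemma cheb_mean_widen n g : (size g <= n)%N ->
  cheb_mean g = \sum_(i < n) g`_i * cos_moment i.
Proof.
move=> gn; rewrite /cheb_mean (big_ord_widen n (fun i => g`_i * cos_moment i) gn).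
rewrite big_mkcond; apply: eq_bigr => i _; case: ltnP => // hi.
by rewrite nth_default ?mul0r.
Qed.

Lemma cheb_mean_is_linear : linear (cheb_mean : {poly R} -> R^o).
Proof.
move=> a g h; pose n := maxn (size (a *: g + h)) (maxn (size g) (size h)).
rewrite !(@cheb_mean_widen n) /n ?leq_max ?leqnn ?orbT//.
rewrite /GRing.scale/= mulr_sumr -big_split; apply: eq_bigr => i _.
by rewrite coefD coefZ mulrDl mulrA.
Qed.
HB.instance Definition _ := GRing.isLinear.Build R {poly R} R^o _
  (cheb_mean : {poly R} -> R^o) cheb_mean_is_linear.

Lemma cheb_meanB g h : cheb_mean (g - h) = cheb_mean g - cheb_mean h.
Proof. exact: (raddfB (cheb_mean : {poly R} -> R^o)). Qed.

Lemma cheb_meanZ a g : cheb_mean (a *: g) = a * cheb_mean g.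
Proof.
have := linearP (cheb_mean : {poly R} -> R^o) a g 0.
by rewrite !addr0 (raddf0 (cheb_mean : {poly R} -> R^o)) addr0.
Qed.

Lemma cheb_mean_sum (I : Type) (r : seq I) (P : pred I) (F : I -> {poly R}) :
  cheb_mean (\sum_(i <- r | P i) F i) = \sum_(i <- r | P i) cheb_mean (F i).
Proof. exact: (raddf_sum (cheb_mean : {poly R} -> R^o)). Qed.

Lemma cheb_meanXn k : cheb_mean 'X^k = cos_moment k.
Proof.
rewrite (@cheb_mean_widen k.+1) ?size_polyXn// big_ord_recr/= coefXn eqxx mul1r.
rewrite big1 ?add0r// => i _.
by rewrite coefXn ltn_eqF// mul0r.
Qed.

Lemma cheb_mean_ge0 g : (forall t, -1 <= t <= 1 -> 0 <= g.[t]) ->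
  0 <= cheb_mean g.
Proof.
move=> g0; rewrite -(pmulr_rge0 _ (pi_gt0 R)).
(* [F] is the antiderivative of g (cos t) that vanishes at 0, so [F pi] inherits the sign of the
   integrand. *)
pose F := fun t : R => \sum_(i < size g) g`_i * cos_antideriv i t.
have -> : pi * cheb_mean g = F pi.
  rewrite /F mulr_sumr; apply: eq_bigr => i _.
  by rewrite cos_antideriv_pi mulrCA.
have <- : F 0 = 0 by rewrite /F big1// => i _; rewrite cos_antideriv_at0 mulr0.
apply: (@le_of_derive_ge0 _ _ (fun t => g.[cos t])); first exact: pi_ge0.
  move=> t _; rewrite horner_coef.
  rewrite (_ : F = \sum_(i < size g) (fun t => g`_i * cos_antideriv i t)).
    apply: is_derive_eq.
      apply: is_derive_sum => i.
      exact: (@is_deriveZ _ _ _ (cos_antideriv i) g`_i t 1 _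
        (is_derive_cos_antideriv i t)).
    by [].
  by apply/funext => u; rewrite fct_sumE.
by move=> t _; apply: g0; rewrite cos_geN1 cos_le1.
Qed.

(** [cheb_mean] is the mean for the arcsine weight on [-1, 1], so these are moments of the
    Gegenbauer weight (1 - t^2)^(p - 1/2), not normalised to total mass 1. *)
Definition gegenbauer_moment p k := cheb_mean ((1 - 'X^2) ^+ p * 'X^k).

Lemma gegenbauer_momentS p k : gegenbauer_moment p.+1 k =
  gegenbauer_moment p k - gegenbauer_moment p k.+2.
Proof.
rewrite /gegenbauer_moment -cheb_meanB; congr cheb_mean.
by rewrite exprSr -(add2n k) exprD; ring.
Qed.

(** Wallis's recursion for the Gegenbauer weight: by [gegenbauer_momentS], its instances for [p] at
    [k] and [k.+2] combine into the one for [p.+1]. *)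
Lemma gegenbauer_momentSS p k : (k + p.*2).+2%:R * gegenbauer_moment p k.+2 =
  k.+1%:R * gegenbauer_moment p k.
Proof.
elim: p k => [|p IH] k.
  rewrite addn0 /gegenbauer_moment !expr0 !mul1r !cheb_meanXn.
  exact: cos_momentSS.
have /= h1 := IH k; have /= h2 := IH k.+2.
rewrite !gegenbauer_momentS.
move: h1 h2; set a := gegenbauer_moment p k; set b := gegenbauer_moment p k.+2.
set c := gegenbauer_moment p k.+4.
rewrite doubleS !addnS !addSn -!muln2 -!natr1 !natrD natrM => h1 h2.
have c0 : 0 < k%:R + p%:R * 2 + 1 + 1 :> R.
  by have := ler0n R k; have := ler0n R p; lra.
have {}h1 : a = (k%:R + p%:R * 2 + 1 + 1) * b / (k%:R + 1).
  by rewrite h1 mulrC mulKf// natr1 pnatr_eq0.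
have kp : k%:R + 1 != 0 :> R by rewrite natr1 pnatr_eq0.
apply: (mulfI (lt0r_neq0 c0)); rewrite h1.
have -> : (k%:R + p%:R * 2 + 1 + 1 + 1 + 1) * (b - c) =
  (k%:R + p%:R * 2 + 1 + 1 + 1 + 1) * b - (k%:R + 1 + 1 + 1) * b.
  by rewrite -h2; ring.
by field.
Qed.

Lemma gegenbauer_moment_odd p k : gegenbauer_moment p k.*2.+1 = 0.
Proof.
elim: k => [|k IH].
  elim: p => [|p IH]; first by rewrite /gegenbauer_moment expr0 mul1r cheb_meanXn.
  rewrite gegenbauer_momentS IH sub0r; apply/eqP; rewrite oppr_eq0.
  have /eqP := gegenbauer_momentSS p 1; rewrite IH mulr0 mulf_eq0.
  by rewrite pnatr_eq0.
have /eqP := gegenbauer_momentSS p k.*2.+1; rewrite IH mulr0 mulf_eq0.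
by rewrite pnatr_eq0 => /eqP.
Qed.

Lemma gegenbauer_moment0_gt0 p : 0 < gegenbauer_moment p 0.
Proof.
elim: p => [|p IH]; first by rewrite /gegenbauer_moment expr0 mul1r cheb_meanXn ltr01.
have := gegenbauer_momentSS p 0; rewrite gegenbauer_momentS add0n mul1r.
set a := gegenbauer_moment p 0 in IH *; set b := gegenbauer_moment p 2 => h.
have {}h : b = a / p.*2.+2%:R by rewrite -h mulrC mulKf// pnatr_eq0.
rewrite h subr_gt0 ltr_pdivrMr ?ltr0n// ltr_pMr// -[X in X < _]/(1%:R) ltr_nat.
by [].
Qed.

(** Iterates [gegenbauer_momentSS]. The factor 4^i is the one of (2 a b)^(2 i) in the expansion of
    (a^2 + b^2 + 2 a b t)^m. *)
Lemma gegenbauer_moment_even p i : 4 ^+ i * gegenbauer_moment p i.*2 =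
  gegenbauer_moment p 0 * ((i.*2)`!%:R * p`!%:R / (i`!%:R * (p + i)`!%:R)).
Proof.
have f0 n : n`!%:R != 0 :> R by rewrite pnatr_eq0 -lt0n fact_gt0.
elim: i => [|i IH].
  by rewrite expr0 addn0 mul1r !fact0 !mul1r divff ?mulr1.
have h := gegenbauer_momentSS p i.*2; rewrite doubleS.
have c0 : (i.*2 + p.*2).+2%:R != 0 :> R by rewrite pnatr_eq0.
apply: (mulfI c0); rewrite mulrCA h exprSr.
transitivity (4 * i.*2.+1%:R * (4 ^+ i * gegenbauer_moment p i.*2)); first ring.
rewrite IH addnS !factS !natrM.
rewrite -!muln2 -!(natr1 (_ + _)%N) -!(natr1 (_.+1)%N) -!(natr1 (i * 2)%N) -!(natr1 i).
rewrite !natrD !natrM.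
field.
have := ler0n R i; have := ler0n R p => p0 i0.
rewrite !f0 /= ?andbT; apply/andP; split; apply: lt0r_neq0; lra.
Qed.

Lemma sum_doubled (V : nmodType) (F : nat -> V) n :
  \sum_(k < n.*2) F k = \sum_(i < n) (F i.*2 + F i.*2.+1).
Proof.
elim: n => [|n IH]; first by rewrite !big_ord0.
by rewrite doubleS !big_ord_recr/= IH addrA.
Qed.

Lemma natr_bin n k : (k <= n)%N ->
  'C(n, k)%:R = n`!%:R / (k`!%:R * (n - k)`!%:R) :> R.
Proof.
move=> kn; rewrite -(bin_fact kn) -natrM natrM mulfK// pnatr_eq0 -lt0n muln_gt0 !fact_gt0.
Qed.

(** The form in which the kernels of differentiated Durrmeyer operators arise in [bern_bern_ker];
    [cheb_mean_gegenbauer_ker] identifies it with the normalised Gegenbauer mean of (A + B + 2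
    sqrt(A B) t)^m. *)
Definition gegenbauer_ker p m (A B : R) : R := \sum_(j < m.+1)
  'C(m, j)%:R * 'C(m + p.*2, j + p)%:R / 'C(m + p.*2, p)%:R * (A ^+ j * B ^+ (m - j)).

(** Here l = j - i and r = m - j - i. With these as variables every subtraction is exact, and both
    sides are the same quotient of factorials. *)
Lemma gegenbauer_ker_coef p i l r : let m := (i + l + (i + r))%N in
  'C(m, i.*2)%:R * ((i.*2)`!%:R * p`!%:R / (i`!%:R * (p + i)`!%:R)) *
    'C(m - i.*2, l)%:R =
  m`!%:R * p`!%:R / ((i + l)`!%:R * (i + r + p)`!%:R) *
    ('C(i + l, i)%:R * 'C(i + r + p, i + p)%:R) :> R.
Proof.
have f0 n : n`!%:R != 0 :> R by rewrite pnatr_eq0 -lt0n fact_gt0.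
move=> m.
have e1 : (m - i.*2 = l + r)%N by rewrite /m; lia.
have e2 : (i + l - i = l)%N by lia.
have e3 : (i + r + p - (i + p) = r)%N by lia.
have e4 : (l + r - l = r)%N by lia.
rewrite (@natr_bin m) ?(@natr_bin (m - _)) ?(@natr_bin (i + l)) ?(@natr_bin (i + r + p)); try (rewrite /m; lia).
rewrite !e1 e2 e3 e4 (addnC p i).
by field; rewrite !f0.
Qed.

Lemma gegenbauer_ker_norm p m j : (j <= m)%N ->
  'C(m, j)%:R * 'C(m + p.*2, j + p)%:R / 'C(m + p.*2, p)%:R =
  m`!%:R * p`!%:R / (j`!%:R * (m - j + p)`!%:R) * 'C(m + p, j + p)%:R :> R.
Proof.
have f0 n : n`!%:R != 0 :> R by rewrite pnatr_eq0 -lt0n fact_gt0.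
move=> jm; rewrite !natr_bin ?leq_add2r//; try lia.
have -> : (m + p.*2 - (j + p) = m - j + p)%N by lia.
have -> : (m + p.*2 - p = m + p)%N by lia.
have -> : (m + p - (j + p) = m - j)%N by lia.
by field; rewrite !f0.
Qed.

(** Vandermonde's convolution, once the second factor is reflected to ['C(m - j + p, m - j - i)]. *)
Lemma sum_bin_bin p m j : (j <= m)%N ->
  \sum_(i < m.+1 | (i <= j)%N && (i <= m - j)%N)
     'C(j, i)%:R * 'C(m - j + p, i + p)%:R = 'C(m + p, j + p)%:R :> R.
Proof.
move=> jm.
have -> : 'C(m + p, j + p) = 'C(j + (m - j + p), m - j).
  rewrite -bin_sub; last by lia.
  by congr 'C(_, _); lia.
rewrite -binomial.Vandermonde natr_sum.
rewrite (big_ord_widen m.+1 (fun i => ('C(j, i) * 'C(m - j + p, m - j - i))%:R)); last by lia.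
rewrite [LHS]big_mkcond [RHS]big_mkcond; apply: eq_bigr => i _.
rewrite ltnS; case: (leqP i (m - j)) => imj; rewrite ?andbF// andbT.
case: leqP => ij; last by rewrite bin_small// mul0n.
rewrite natrM; congr (_ * _%:R); rewrite -bin_sub; last by lia.
by congr 'C(_, _); lia.
Qed.

Lemma sum_ord_trim (V : nmodType) (F : nat -> V) i m : (i.*2 <= m)%N ->
  \sum_(j < m.+1 | (i <= j)%N && (i <= m - j)%N) F j =
  \sum_(l < (m - i.*2).+1) F (i + l)%N.
Proof.
move=> im; rewrite big_mkcond.
rewrite -(big_mkord xpredT (fun j => if (i <= j)%N && (i <= m - j)%N then F j else 0)).
rewrite [X in \sum_(0 <= _ < X) _](_ : m.+1 = i + ((m - i.*2).+1 + i))%N; last by lia.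
rewrite big_mkord !big_split_ord/= big1 ?add0r => [|j _]; last first.
  by have := ltn_ord j; rewrite ltnNge => /negPf ->.
rewrite [X in _ + X]big1 ?addr0 => [|j _]; last first.
  by rewrite (_ : (i <= m - _)%N = false) ?andbF//; apply/negbTE; have := ltn_ord j; lia.
apply: eq_bigr => j _; rewrite (_ : (_ && _) = true)//.
by have := ltn_ord j; lia.
Qed.

(** In the binomial expansion only even powers of t contribute. With A = a^2 and B = b^2, expanding
    (A + B)^(m - 2 i) and collecting A^j B^(m - j) leaves for each j a sum over i that [sum_bin_bin]
    evaluates. *)
Lemma cheb_mean_gegenbauer_ker p m (a b : R) :
  cheb_mean ((1 - 'X^2) ^+ p *
    ((a ^+ 2 + b ^+ 2)%:P + (2 * a * b) *: 'X) ^+ m) =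
  gegenbauer_moment p 0 * gegenbauer_ker p m (a ^+ 2) (b ^+ 2).
Proof.
set s0 := a ^+ 2 + b ^+ 2; set z := 2 * a * b.
pose F k := 'C(m, k)%:R * s0 ^+ (m - k) * z ^+ k * gegenbauer_moment p k.
transitivity (\sum_(k < m.+1) F k).
  rewrite [(_ + _ *: 'X) ^+ _]exprDn mulr_sumr cheb_mean_sum; apply: eq_bigr => k _.
  rewrite /F -cheb_meanZ; congr cheb_mean.
  rewrite exprZn -polyC_exp -mulr_natl -!mul_polyC !polyCM polyC_natr.
  by ring.
(* The odd moments vanish. The range is enlarged to 2 (m + 1) indices so that it splits into pairs;
   the new terms are 0 because ['C(m, k)] is, for k > m. *)
transitivity (\sum_(i < m.+1) F i.*2).
  rewrite (big_ord_widen m.+1.*2) -?addnn ?leq_addl//.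
  rewrite big_mkcond (eq_bigr (fun k : 'I_(m.+1 + m.+1) => F k)); last first.
    by move=> k _; case: ltnP => // mk; rewrite /F bin_small// !mul0r.
  rewrite addnn sum_doubled; apply: eq_bigr => i _.
  by rewrite [F i.*2.+1]/F gegenbauer_moment_odd mulr0 addr0.
pose d i := 'C(m, i.*2)%:R * ((i.*2)`!%:R * p`!%:R / (i`!%:R * (p + i)`!%:R)) : R.
pose A := a ^+ 2; pose B := b ^+ 2.
pose G i j := d i * 'C(m - i.*2, j - i)%:R * (A ^+ j * B ^+ (m - j)).
transitivity (gegenbauer_moment p 0 * \sum_(i < m.+1)
    \sum_(j < m.+1 | (i <= j)%N && (i <= m - j)%N) G i j).
  rewrite mulr_sumr; apply: eq_bigr => i _.
  (* For 2 i > m the binomial coefficient is 0 and the inner range is empty. *)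
  case: (leqP i.*2 m) => im; last first.
    rewrite /F bin_small// !mul0r big1 ?mulr0// => j /andP[ij imj].
    by exfalso; have := ltn_ord j; lia.
  have -> : F i.*2 = gegenbauer_moment p 0 * (d i * (A * B) ^+ i * (B + A) ^+ (m - i.*2)).
    have zE : z ^+ i.*2 = 4 ^+ i * (A ^+ i * B ^+ i).
      rewrite -mul2n exprM /z -!exprMn; congr (_ ^+ _).
      by rewrite /A /B; ring.
    rewrite /F zE [B + A]addrC -/s0.
    transitivity ('C(m, i.*2)%:R * s0 ^+ (m - i.*2) * (A ^+ i * B ^+ i) *
      (4 ^+ i * gegenbauer_moment p i.*2)); first by ring.
    rewrite gegenbauer_moment_even /d [(A * B) ^+ i]exprMn.
    by move: (_ / (i`!%:R * _)) (s0 ^+ _) => u v; ring.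
  congr (_ * _); rewrite (sum_ord_trim (G i))// exprDn mulr_sumr.
  apply: eq_bigr => l _; have := ltn_ord l => hl.
  rewrite /G addKn -mulr_natl exprMn exprD.
  have -> : (m - (i + l) = i + (m - i.*2 - l))%N by lia.
  by rewrite exprD; ring.
congr (_ * _); rewrite (exchange_big_dep xpredT)//=; apply: eq_bigr => j _.
have jm : (j <= m)%N by rewrite -ltnS.
rewrite -mulr_suml; congr (_ * _); rewrite gegenbauer_ker_norm// -sum_bin_bin// mulr_sumr.
apply: eq_bigr => i /andP[ij imj]; rewrite /d.
have := gegenbauer_ker_coef p i (j - i) (m - j - i).
rewrite /= !subnKC//.
Qed.

Definition gegenbauer_op p (G : {poly R}) (A B : R) : R :=
  \sum_(m < size G) G`_m * gegenbauer_ker p m A B.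

(* The operator is a mean of the values of [G] at [A + B + 2 sqrt(AB) t], for
   the weight [(1 - t^2)^(p - 1/2)] on [-1, 1]. *)
Lemma gegenbauer_op_ge0 p (G : {poly R}) (x u : R) :
  (forall s, 0 <= s <= 1 -> 0 <= G.[s]) -> 0 <= x <= 1 -> 0 <= u <= 1 ->
  0 <= gegenbauer_op p G (x * u) ((1 - x) * (1 - u)).
Proof.
move=> G0 /andP[x0 x1] /andP[u0 u1].
pose a := Num.sqrt (x * u); pose b := Num.sqrt ((1 - x) * (1 - u)).
have x1' : 0 <= 1 - x by rewrite subr_ge0.
have u1' : 0 <= 1 - u by rewrite subr_ge0.
have aE : a ^+ 2 = x * u by rewrite sqr_sqrtr// mulr_ge0.
have bE : b ^+ 2 = (1 - x) * (1 - u) by rewrite sqr_sqrtr// mulr_ge0.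
have a0 : 0 <= a := sqrtr_ge0 _.
have b0 : 0 <= b := sqrtr_ge0 _.
have ab0 : 0 <= a * b by rewrite mulr_ge0.
(* The squares of the two sides differ by (x - u)^2. The right side is 1 - a^2 - b^2, so a^2 + b^2 +
   2 a b t stays at most 1 for t in [-1, 1]. *)
have ab : 2 * a * b <= x * (1 - u) + u * (1 - x).
  rewrite -ler_sqr ?nnegrE -?mulrA ?mulr_ge0 ?addr_ge0 ?mulr_ge0//.
  rewrite !exprMn aE bE -subr_ge0.
  have -> : (x * (1 - u) + u * (1 - x)) ^+ 2 - 2 ^+ 2 * (x * u * ((1 - x) * (1 - u))) = (x - u) ^+ 2 by ring.
  exact: sqr_ge0.
rewrite -(pmulr_rge0 _ (gegenbauer_moment0_gt0 p)) -aE -bE.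
pose L : {poly R} := (a ^+ 2 + b ^+ 2)%:P + (2 * a * b) *: 'X.
have -> : gegenbauer_moment p 0 * gegenbauer_op p G (a ^+ 2) (b ^+ 2) =
    cheb_mean ((1 - 'X^2) ^+ p * (G \Po L)).
  rewrite /gegenbauer_op mulr_sumr comp_polyE mulr_sumr cheb_mean_sum.
  apply: eq_bigr => m _; rewrite -[X in cheb_mean X]scalerAr cheb_meanZ cheb_mean_gegenbauer_ker.
  by rewrite mulrCA.
apply: cheb_mean_ge0 => t /andP[t1 t2].
rewrite hornerM horner_comp mulr_ge0//.
  rewrite !hornerE exprn_ge0//; nra.
apply: G0; rewrite /L !hornerE.
have ab2 : 0 <= (a - b) ^+ 2 := sqr_ge0 _.
have abt1 : - (a * b) <= a * b * t by nra.
have abt2 : a * b * t <= a * b by nra.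
apply/andP; split; first by nra.
rewrite aE bE; lra.
Qed.

End ChebyshevFunctional.

(** * Mixtures of genuine Bernstein-Durrmeyer operators *)

Section GenuineDurrmeyer.
Variable R : realType.
Implicit Types (p g G H : {poly R}).

(** The usual coefficients, values at the end points and means against Bernstein polynomials inside,
    are recovered in [durr_coef0], [durr_coef_last] and [durr_coef_bern]. The summed form makes
    their differences integrals of p'. *)
Definition durr_coef n p (j : nat) : R :=
  p.[0] + \sum_(i < j) int01 (bern R n i * p^`()).

Lemma durr_coef0 n p : durr_coef n p 0 = p.[0].
Proof. by rewrite /durr_coef big_ord0 addr0. Qed.

(* The genuine Bernstein-Durrmeyer operator of degree [n + 1]. *)
Definition durr n p : {poly R} := bsum n.+1 (durr_coef n p).

Lemma durr_coef_is_linear n a p g j :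
  durr_coef n (a *: p + g) j = a * durr_coef n p j + durr_coef n g j.
Proof.
rewrite /durr_coef hornerD hornerZ mulrDr addrACA; congr (_ + _).
rewrite mulr_sumr -big_split; apply: eq_bigr => i _.
by rewrite derivD derivZ mulrDr int01D -scalerAr int01Z.
Qed.

Lemma durr_is_linear n : linear (durr n).
Proof.
move=> a p g; rewrite /durr -bsumP; apply: eq_bsum => j _.
exact: durr_coef_is_linear.
Qed.
HB.instance Definition _ n := GRing.isLinear.Build R {poly R} {poly R} _
  (durr n) (durr_is_linear n).

Lemma diff_durr_coef n p :
  diff_seq (durr_coef n p) = fun j => int01 (bern R n j * p^`()).
Proof.
by apply/funext => j; rewrite /diff_seq /durr_coef big_ord_recr/= addrA [_ + int01 _]addrC addrK.
Qed.

(** A difference of Bernstein polynomials is the derivative of one of higher degree, and integration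
    by parts moves that derivative to [g]. The boundary terms vanish because the index stays
    strictly inside its range. *)
Lemma iter_diff_int01_bern s M g j : (j + s <= M)%N ->
  iter s (@diff_seq R) (fun i => int01 (bern R M i * g)) j =
  M`!%:R / (M + s)`!%:R * int01 (bern R (M + s) (j + s) * g^`(s)).
Proof.
elim: s j => [|s IH] j jM.
  by rewrite !addn0 divff ?mul1r// pnatr_eq0 -lt0n fact_gt0.
rewrite iterS {1}/diff_seq !IH; try lia.
rewrite -mulrBr -int01B -mulrBl.
have c0 : (M + s).+1%:R != 0 :> R by rewrite pnatr_eq0.
have -> : int01 ((bern R (M + s) (j.+1 + s) - bern R (M + s) (j + s)) * g^`(s)) =
    (M + s).+1%:R^-1 * int01 (bern R (M + s).+1 (j + s).+1 * g^`(s.+1)).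
  apply: (mulfI c0); rewrite mulrA divff// mul1r -int01Z.
  rewrite addSn -opprB mulNr scalerN -scaleNr [_ *: (_ * _)]scalerAl scaleNr -deriv_bernS mulNr.
  rewrite -scaleN1r int01Z int01_by_parts bern_at1 bern_at0 eqn_leq.
  rewrite (_ : ((M + s).+1 <= (j + s).+1)%N = false) ?andbF; last by apply/negbTE; lia.
  by rewrite !mul0r subrr sub0r mulN1r opprK derivnS.
rewrite !addnS mulrA; congr (_ * _).
by rewrite factS natrM invfM mulrA [RHS]mulrAC.
Qed.

Lemma derivn_durr s m p : (durr (m + s) p)^`(s.+1) =
  ((s.+1 + m) ^_ s.+1)%:R *: bsum m (fun j => (m + s)`!%:R / (m + s + s)`!%:R *
     int01 (bern R (m + s + s) (j + s) * p^`(s.+1))).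
Proof.
rewrite /durr -addnS derivn_bsum addnC; congr (_ *: _).
apply: eq_bsum => j jm; rewrite iterSr diff_durr_coef iter_diff_int01_bern ?leq_add2r//.
by rewrite derivSn.
Qed.

(** The partial sum [S] of Bernstein polynomials has a telescoping derivative and goes from 1 at 0
    to 0 at 1; integration by parts removes the derivative of [p]. *)
Lemma durr_coef_bern n p j : (j <= n)%N ->
  durr_coef n.+1 p j.+1 = n.+1%:R * int01 (bern R n j * p).
Proof.
move=> jn; rewrite /durr_coef -int01_sum -mulr_suml.
set S := \sum_(i < j.+1) _.
have S0 : S.[0] = 1.
  rewrite /S horner_sum big_ord_recl bern_at0 big1 ?addr0// => i _.
  by rewrite bern_at0.
have S1 : S.[1] = 0.
  rewrite /S horner_sum big1// => i _.
  by rewrite bern_at1 ltn_eqF//; have := ltn_ord i; lia.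
have dS : S^`() = - n.+1%:R *: bern R n j.
  rewrite /S raddf_sum {S S0 S1}/= big_ord_recl deriv_bern0.
  elim: j jn => [|j IH] jn; first by rewrite big_ord0 addr0.
  rewrite big_ord_recr/= addrA IH 1?ltnW// /bump/= add1n deriv_bernS.
  by rewrite !scaleNr scalerBr addrA addNr sub0r.
have := int01_by_parts S p; rewrite S0 S1 dS mul0r mul1r sub0r -scalerAl int01Z.
by move=> h; rewrite -[RHS]opprK -mulNr h opprB opprK addrC.
Qed.

Lemma durr_coef_last n p : durr_coef n p n.+1 = p.[1].
Proof.
by rewrite /durr_coef -int01_sum -mulr_suml sum_bern mul1r int01_deriv addrC subrK.
Qed.

(** [durr i] has degree [i.+1], hence the shift of index. The coefficients of [H] may have either
    sign, so positivity is not inherited term by term. *)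
Definition durr_mix H p : {poly R} := \sum_(i < (size H).-1) H`_i.+1 *: durr i p.

Lemma durr_mix_widen n H p : ((size H).-1 <= n)%N ->
  durr_mix H p = \sum_(i < n) H`_i.+1 *: durr i p.
Proof.
move=> Hn; rewrite /durr_mix (big_ord_widen n (fun i => H`_i.+1 *: durr i p))//.
rewrite big_mkcond; apply: eq_bigr => i _; case: ltnP => // hi.
by rewrite nth_default ?scale0r// (leq_trans (leqSpred _)).
Qed.

Lemma durr_mix_is_linear H : linear (durr_mix H).
Proof.
move=> a p g; rewrite /durr_mix scaler_sumr -big_split; apply: eq_bigr => i _.
by rewrite linearP scalerDr !scalerA mulrC.
Qed.
HB.instance Definition _ H := GRing.isLinear.Build R {poly R} {poly R} _
  (durr_mix H) (durr_mix_is_linear H).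

Lemma size_durr_mix H p : (size (durr_mix H p) <= size H)%N.
Proof.
apply: (leq_trans (size_sum _ _ _)); apply/bigmax_leqP => i _.
apply: (leq_trans (size_scale_leq _ _)); apply: (leq_trans (size_bsum _ _)).
by have := ltn_ord i; lia.
Qed.

Lemma gegenbauer_op_widen n q G A B : (size G <= n)%N ->
  gegenbauer_op q G A B = \sum_(m < n) G`_m * gegenbauer_ker q m A B.
Proof.
move=> Gn; rewrite /gegenbauer_op.
rewrite (big_ord_widen n (fun m => G`_m * gegenbauer_ker q m A B))//.
rewrite big_mkcond; apply: eq_bigr => i _; case: ltnP => // hi.
by rewrite nth_default ?mul0r.
Qed.

Lemma derivn_sum n (F : 'I_n -> {poly R}) s :
  (\sum_(i < n) F i)^`(s) = \sum_(i < n) (F i)^`(s).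
Proof. exact: (linear_sum (derivn s : {poly R} -> {poly R})). Qed.

Lemma size_derivn_le H s : (size H^`(s) <= size H)%N.
Proof.
apply/leq_sizeP => j hj; rewrite coef_derivn nth_default ?mul0rn//.
by rewrite (leq_trans hj)// leq_addl.
Qed.

(** Up to the weight (u (1 - u))^s, each product of Bernstein polynomials in x and u is a monomial
    in x u and (1 - x) (1 - u), with exactly the coefficient of [gegenbauer_ker s m]. *)
Lemma bern_bern_ker s m j (x u : R) : (j <= m)%N ->
  (m + s)`!%:R / (m + s + s)`!%:R * (bern R (m + s + s) (j + s)).[u] * (bern R m j).[x] =
  (u * (1 - u)) ^+ s / s`!%:R * ('C(m, j)%:R * 'C(m + s.*2, j + s)%:R / 'C(m + s.*2, s)%:R *
    ((x * u) ^+ j * ((1 - x) * (1 - u)) ^+ (m - j))).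
Proof.
have f0 n : n`!%:R != 0 :> R by rewrite pnatr_eq0 -lt0n fact_gt0.
move=> jm; rewrite !horner_bern -!addnA addnn.
rewrite (@natr_bin _ (m + s.*2) s); last by lia.
have -> : (m + s.*2 - s = m + s)%N by lia.
have -> : (m + s.*2 - (j + s) = (m - j) + s)%N by lia.
rewrite !exprMn !exprD; field; rewrite !f0.
by [].
Qed.

Lemma horner_derivn_durr_mix s H p x : (durr_mix H p)^`(s.+1).[x] =
  int01 ((\sum_(m < size H) \sum_(j < m.+1)
    (H^`(s.+1)`_m * ((m + s)`!%:R / (m + s + s)`!%:R) * (bern R m j).[x]) *:
      bern R (m + s + s) (j + s)) * p^`(s.+1)).
Proof.
(* The first s operators have degree at most s and disappear under s + 1 derivatives. *)
rewrite (@durr_mix_widen (s + size H)) ?big_split_ord; last by lia.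
rewrite derivnD hornerD !derivn_sum !horner_sum big1 ?add0r => [|i _]; last first.
  rewrite derivnZ derivn_poly0 ?scaler0 ?horner0//.
  by apply: (leq_trans (size_bsum _ _)); rewrite /= !ltnS ltn_ord.
rewrite mulr_suml int01_sum; apply: eq_bigr => m _.
rewrite derivnZ -[nat_of_ord (rshift s m)]/(s + m)%N [(s + m)%N]addnC derivn_durr !hornerZ mulr_suml int01_sum /bsum horner_sum !mulr_sumr.
apply: eq_bigr => j _; rewrite hornerZ int01Zl coef_derivn -(mulr_natr H`__).
by rewrite addSn [(s + m)%N]addnC; ring.
Qed.

Lemma derivn_durr_mix_ge0 s H p :
  (forall x, 0 <= x <= 1 -> 0 <= H^`(s.+1).[x]) ->
  (forall x, 0 <= x <= 1 -> 0 <= p^`(s.+1).[x]) ->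
  forall x, 0 <= x <= 1 -> 0 <= (durr_mix H p)^`(s.+1).[x].
Proof.
move=> H0 p0 x x01; rewrite horner_derivn_durr_mix; apply: int01_ge0 => u u01.
rewrite hornerM mulr_ge0 ?p0//.
(* Weighted by the coefficients of the derivative of [H] of order s + 1, the monomial kernels add up
   to the Gegenbauer mean of that derivative. *)
have -> : (\sum_(m < size H) \sum_(j < m.+1)
    (H^`(s.+1)`_m * ((m + s)`!%:R / (m + s + s)`!%:R) * (bern R m j).[x]) *:
      bern R (m + s + s) (j + s)).[u] =
    (u * (1 - u)) ^+ s / s`!%:R *
      gegenbauer_op s H^`(s.+1) (x * u) ((1 - x) * (1 - u)).
  rewrite (@gegenbauer_op_widen (size H)) ?size_derivn_le// horner_sum mulr_sumr.
  apply: eq_bigr => m _; rewrite horner_sum /gegenbauer_ker !mulr_sumr.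
  apply: eq_bigr => j _; have jm : (j <= m)%N by rewrite -ltnS.
  by rewrite hornerZ [RHS]mulrCA -bern_bern_ker//; ring.
have /andP[u0 u1] := u01.
rewrite mulr_ge0 ?gegenbauer_op_ge0// divr_ge0 ?ler0n// exprn_ge0// mulr_ge0//.
by rewrite subr_ge0.
Qed.

Lemma horner_durr n p x : (durr n.+1 p).[x] =
  p.[0] * (1 - x) ^+ n.+2 + p.[1] * x ^+ n.+2 +
  n.+1%:R * int01 ((\sum_(j < n.+1) (bern R n.+2 j.+1).[x] *: bern R n j) * p).
Proof.
rewrite /durr /bsum horner_sum big_ord_recl big_ord_recr/= !hornerZ.
rewrite durr_coef_last durr_coef0.
rewrite !horner_bern bin0 /bump/= !add1n binn subn0 subnn !expr0 !mul1r mulr1.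
rewrite -addrA; congr (_ + _); rewrite addrC; congr (_ + _).
rewrite mulr_suml int01_sum mulr_sumr; apply: eq_bigr => j _.
by rewrite hornerZ /bump add1n durr_coef_bern -1?ltnS// int01Zl; ring.
Qed.

Lemma horner_durr0 p x : (durr 0 p).[x] = p.[0] * (1 - x) + p.[1] * x.
Proof.
rewrite /durr /bsum horner_sum big_ord_recl big_ord_recl big_ord0/= !hornerZ addr0.
rewrite durr_coef_last durr_coef0 !horner_bern.
by rewrite bin0 binn subn0 subnn !expr0 !mul1r !expr1 mulr1.
Qed.

Lemma horner_durr_mix H p x : H`_0 = 0 -> (durr_mix H p).[x] =
  p.[0] * H.[1 - x] + p.[1] * H.[x] +
  int01 ((\sum_(m < size H) \sum_(j < m.+1)
    (H`_m.+2 * m.+1%:R * (bern R m.+2 j.+1).[x]) *: bern R m j) * p).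
Proof.
move=> H0; have Hx y : H.[y] = \sum_(i < (size H).+1) H`_i.+1 * y ^+ i.+1.
  have hs : (size H <= (size H).+2)%N by lia.
  rewrite (horner_coef_wide y hs) big_ord_recl H0 mul0r add0r.
  by apply: eq_bigr => i _.
rewrite (@durr_mix_widen (size H).+1); last by lia.
rewrite !Hx !mulr_sumr -big_split/= horner_sum !big_ord_recl/= hornerZ horner_durr0.
rewrite -[RHS]addrA; congr (_ + _); first by rewrite !expr1; ring.
rewrite mulr_suml int01_sum -big_split/=; apply: eq_bigr => m _.
rewrite hornerZ /bump !add1n horner_durr !mulrDr; congr (_ + _).
  by congr (_ + _); rewrite mulrCA.
rewrite !mulr_suml !int01_sum !mulr_sumr; apply: eq_bigr => j _.
by rewrite !int01Zl; ring.
Qed.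

(** In order 0, [bern m.+2 j.+1] at x supplies a factor x (1 - x), and the rest of the kernel is the
    Gegenbauer mean of H'' for p = 1. Nonnegativity of [H] itself serves the two end point terms. *)
Lemma durr_mix_ge0 H p : H`_0 = 0 ->
  (forall x, 0 <= x <= 1 -> 0 <= H.[x]) ->
  (forall x, 0 <= x <= 1 -> 0 <= H^`(2).[x]) ->
  (forall x, 0 <= x <= 1 -> 0 <= p.[x]) ->
  forall x, 0 <= x <= 1 -> 0 <= (durr_mix H p).[x].
Proof.
move=> H0 Hge Hge2 p0 x x01; rewrite horner_durr_mix//.
have /andP[x0 x1] := x01.
have x01' : 0 <= 1 - x <= 1 by rewrite subr_ge0 x1 lerBlDr lerDl.
rewrite addr_ge0 ?addr_ge0 ?mulr_ge0 ?Hge ?p0 ?lexx ?ler01//.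
apply: int01_ge0 => u u01; rewrite hornerM mulr_ge0 ?p0//.
have -> : (\sum_(m < size H) \sum_(j < m.+1)
    (H`_m.+2 * m.+1%:R * (bern R m.+2 j.+1).[x]) *: bern R m j).[u] =
    x * (1 - x) * gegenbauer_op 1 H^`(2) (x * u) ((1 - x) * (1 - u)).
  rewrite (@gegenbauer_op_widen (size H)) ?size_derivn_le// horner_sum mulr_sumr.
  apply: eq_bigr => m _; rewrite horner_sum /gegenbauer_ker !mulr_sumr.
  apply: eq_bigr => j _; rewrite hornerZ coef_derivn !horner_bern addn1 bin1 addn2 add2n.
  rewrite ffactnS ffactn1 /= subSS -(mulr_natr H`__) natrM.
  rewrite subSn -1?ltnS// !exprS !exprMn.
  have : m.+2%:R != 0 :> R by rewrite pnatr_eq0.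
  by move: (m.+2%:R : R) => c c0; field.
have /andP[u0 u1] := u01.
by rewrite mulr_ge0 ?gegenbauer_op_ge0// mulr_ge0// subr_ge0.
Qed.

Lemma horner1_coefS H n : H`_0 = 0 -> (size H <= n.+1)%N ->
  H.[1] = \sum_(i < n) H`_i.+1.
Proof.
move=> H0 hs; rewrite (horner_coef_wide 1 hs) big_ord_recl H0 mul0r add0r.
by apply: eq_bigr => i _; rewrite expr1n mulr1.
Qed.

Lemma int01_coefS H n : H`_0 = 0 -> (size H <= n.+1)%N ->
  int01 H = \sum_(i < n) H`_i.+1 / i.+2%:R.
Proof.
move=> H0 hs; have hs' : (size (antideriv H) <= n.+2)%N.
  by rewrite (leq_trans (size_antideriv H)).
rewrite /int01 (horner_coef_wide 1 hs') !big_ord_recl !coef_antideriv/= H0 !mul0r.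
rewrite !add0r; apply: eq_bigr => i _.
by rewrite coef_antideriv expr1n mulr1.
Qed.

Lemma durr_const n a : durr n a%:P = a%:P.
Proof.
rewrite /durr (@eq_bsum _ _ _ (fun=> a)) ?bsum_const// => j _.
rewrite /durr_coef hornerC big1 ?addr0// => l _.
by rewrite derivC mulr0 -(scale0r 0) int01Z mul0r.
Qed.

Lemma durr_id n : durr n 'X = 'X.
Proof.
have c0 : n.+1%:R != 0 :> R by rewrite pnatr_eq0.
rewrite /durr (@eq_bsum _ _ _ (fun j => n.+1%:R^-1 * j%:R + (fun=> 0) j)).
  by rewrite bsumP bsum_const addr0 bsum_id scalerA mulVf// scale1r.
move=> j jn; rewrite /durr_coef hornerX add0r addr0 derivX.
rewrite (eq_bigr (fun=> n.+1%:R^-1)); last first.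
  by move=> i _; rewrite mulr1 int01_bern//; have := ltn_ord i; lia.
by rewrite sumr_const card_ord mulr_natr.
Qed.

Lemma int01_bern_X n i : (i <= n)%N ->
  int01 (bern R n i * 'X) = i.+1%:R / (n.+1%:R * n.+2%:R).
Proof.
move=> ni; have c0 : n.+1%:R != 0 :> R by rewrite pnatr_eq0.
have := congr1 (@int01 R) (mulX_bern R n i).
rewrite !int01Z int01_bern// mulrC => h; rewrite mulrC.
by apply: (mulIf c0); rewrite h invfM mulrA mulrAC divfK.
Qed.

Lemma durr_sq n : durr n 'X^2 = 'X^2 + (2 / n.+2%:R) *: ('X - 'X^2).
Proof.
have c0 : n.+1%:R != 0 :> R by rewrite pnatr_eq0.
have c1 : n.+2%:R != 0 :> R by rewrite pnatr_eq0.
pose k : R := (n.+1%:R * n.+2%:R)^-1.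
have e1 : k * (n.+1%:R * (n.+1%:R - 1)) = 1 - 2 / n.+2%:R.
  have e : n.+2%:R = n.+1%:R + 1 :> R by rewrite natr1.
  rewrite /k e; move: c0 c1; rewrite e; move: (n.+1%:R : R) => c c0 c1.
  by field; rewrite c0 c1.
have e2 : 2 * k * n.+1%:R = 2 / n.+2%:R.
  by rewrite /k; move: (n.+1%:R : R) (n.+2%:R : R) c0 c1 => c d c0 d0; field; rewrite c0 d0.
(* Summing [int01_bern_X] gives the coefficients (j (j - 1) + 2 j) / ((n + 1) (n + 2)), a
   combination of factorial moments. *)
rewrite /durr (@eq_bsum _ _ _ (fun j => k * (j%:R * (j%:R - 1)) + (2 * k * j%:R + (fun=> 0) j))).
  rewrite !bsumP bsum_const addr0 bsum_id bsum_sq !scalerA e1 e2.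
  by rewrite scalerBl scale1r scalerBr addrAC addrA.
move=> j jn; rewrite /durr_coef hornerXn expr0n add0r addr0 derivXn /=.
rewrite (eq_bigr (fun i : 'I_j => k * (i.+1%:R * 2))); last first.
  move=> i _; rewrite expr1 -scaler_nat -scalerAr int01Z int01_bern_X; last first.
    by have := ltn_ord i; lia.
  by rewrite /k; ring.
rewrite -mulr_sumr.
have -> : \sum_(i < j) i.+1%:R * 2 = j%:R * (j%:R - 1) + 2 * j%:R :> R.
  elim: j {jn} => [|j IH]; first by rewrite big_ord0 !mul0r mulr0 addr0.
  by rewrite big_ord_recr/= IH -natr1; ring.
by ring.
Qed.

Lemma durr_mix_const H a : H`_0 = 0 -> durr_mix H a%:P = H.[1] *: a%:P.
Proof.
move=> H0; rewrite (@durr_mix_widen (size H)) ?leq_pred// (horner1_coefS H0 (leqnSn _)).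
by rewrite scaler_suml; apply: eq_bigr => i _; rewrite durr_const.
Qed.

Lemma durr_mix_id H : H`_0 = 0 -> durr_mix H 'X = H.[1] *: 'X.
Proof.
move=> H0; rewrite (@durr_mix_widen (size H)) ?leq_pred// (horner1_coefS H0 (leqnSn _)).
by rewrite scaler_suml; apply: eq_bigr => i _; rewrite durr_id.
Qed.

(** The coefficient 2 / (i + 2) in [durr_sq] is twice the integral of X^(i + 1), so the mixture
    turns it into twice the integral of [H]. *)
Lemma durr_mix_sq H : H`_0 = 0 ->
  durr_mix H 'X^2 = H.[1] *: 'X^2 + (2 * int01 H) *: ('X - 'X^2).
Proof.
move=> H0; rewrite (@durr_mix_widen (size H)) ?leq_pred//.
rewrite (horner1_coefS H0 (leqnSn _)) (int01_coefS H0 (leqnSn _)).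
rewrite mulr_sumr !scaler_suml -big_split/=; apply: eq_bigr => i _.
by rewrite durr_sq scalerDr scalerA; congr (_ + _ *: _); ring.
Qed.

End GenuineDurrmeyer.

(** * The polynomial H *)

Section KernelPolynomial.
Variable R : realType.
Implicit Types (p : {poly R}) (t v : R).

(** The shifted Chebyshev polynomial T_j (2 X - 1). *)
Fixpoint cos2_poly (j : nat) : {poly R} :=
  match j with
  | 0 => 1
  | 1 => 2 *: 'X - 1
  | (j'.+1 as j1).+1 => (4 *: 'X - 2%:P) * cos2_poly j1 - cos2_poly j'
  end.

Arguments cos2_poly : simpl never.

Lemma cos2_polySS j :
  cos2_poly j.+2 = (4 *: 'X - 2%:P) * cos2_poly j.+1 - cos2_poly j.
Proof. by []. Qed.

Lemma cos_double t : cos (2 * t) = 2 * cos t ^+ 2 - 1.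
Proof.
by rewrite (_ : 2 * t = t + t) ?cosD; [rewrite -!expr2 sin2cos2; ring|ring].
Qed.

Lemma horner_cos2_poly j t : (cos2_poly j).[cos t ^+ 2] = cos (j%:R * (2 * t)).
Proof.
suff [] : (cos2_poly j).[cos t ^+ 2] = cos (j%:R * (2 * t)) /\
    (cos2_poly j.+1).[cos t ^+ 2] = cos (j.+1%:R * (2 * t)) by [].
elim: j => [|i [h1 h2]].
  split; first by rewrite /cos2_poly hornerE ?mul0r cos0.
  rewrite (_ : 1%:R * (2 * t) = 2 * t); last by ring.
  by rewrite cos_double /cos2_poly !hornerE.
split=> //; rewrite cos2_polySS hornerD hornerN hornerM h1 h2 hornerD hornerN hornerZ hornerX hornerC.
rewrite (_ : i.+2%:R * (2 * t) = i.+1%:R * (2 * t) + 2 * t); last first.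
  by rewrite -(natr1 i.+1); ring.
rewrite (_ : i%:R * (2 * t) = i.+1%:R * (2 * t) - 2 * t); last first.
  by rewrite -(natr1 i); ring.
by rewrite cosB cosD cos_double; ring.
Qed.

Lemma size_cos2_poly j : (size (cos2_poly j) <= j.+1)%N.
Proof.
suff : (size (cos2_poly j) <= j.+1)%N /\ (size (cos2_poly j.+1) <= j.+2)%N by case.
have s2 a b : (size (a *: 'X - b%:P : {poly R})%R <= 2)%N.
  rewrite (leq_trans (size_polyD _ _))// geq_max size_polyN.
  by rewrite (leq_trans (size_scale_leq _ _)) ?size_polyX// (leq_trans (size_polyC_leq1 _)).
elim: j => [|j [h1 h2]].
  by rewrite size_poly1; split=> //; exact: (s2 2 1).
split=> //; rewrite cos2_polySS (leq_trans (size_polyD _ _))// geq_max size_polyN.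
rewrite (leq_trans h1) ?andbT; last by lia.
rewrite (leq_trans (size_polyMleq _ _))//; have := s2 4 2; lia.
Qed.

(* Takes the value [sin ((2 d + 1) t) / sin t] at [cos t ^+ 2]. *)
Definition dirichlet_poly d : {poly R} := 1 + \sum_(j < d) 2 *: cos2_poly j.+1.

Lemma horner_dirichlet_poly d t :
  (dirichlet_poly d).[cos t ^+ 2] * sin t = sin (d.*2.+1%:R * t).
Proof.
elim: d => [|d IH]; first by rewrite /dirichlet_poly big_ord0 addr0 hornerE !mul1r.
rewrite /dirichlet_poly big_ord_recr/= addrA hornerD mulrDl IH.
rewrite hornerZ horner_cos2_poly.
pose s : R := d.+1%:R * (2 * t).
rewrite (_ : d.*2.+1%:R * t = s - t); last first.
  by rewrite /s -muln2 -!natr1 natrM; ring.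
rewrite (_ : d.+1.*2.+1%:R * t = s + t); last first.
  by rewrite /s -muln2 -!natr1 natrM; ring.
by rewrite -/s sinB sinD; ring.
Qed.

Lemma size_dirichlet_poly d : (size (dirichlet_poly d) <= d.+1)%N.
Proof.
rewrite (leq_trans (size_polyD _ _))// geq_max size_poly1/=.
rewrite (leq_trans (size_sum _ _ _))//; apply/bigmax_leqP => j _.
rewrite (leq_trans (size_scale_leq _ _))// (leq_trans (size_cos2_poly _))//.
by have := ltn_ord j; lia.
Qed.

Lemma sin_natmul_le j t : `|sin (j%:R * t)| <= j%:R * `|sin t|.
Proof.
elim: j => [|j IH]; first by rewrite !mul0r sin0 normr0.
rewrite -natr1 !mulrDl !mul1r sinD (le_trans (ler_normD _ _))// !normrM lerD//.
  by rewrite (le_trans _ IH)// ler_piMr// cos_max.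
by rewrite ler_piMl// cos_max.
Qed.

Lemma cos_sq_surj v : 0 <= v <= 1 -> exists t, cos t ^+ 2 = v.
Proof.
move=> /andP[v0 v1].
exists (acos (Num.sqrt v)); rewrite acosK ?sqr_sqrtr// in_itv/=.
rewrite (le_trans _ (sqrtr_ge0 _)) ?oppr_le0//=.
by rewrite -sqrtr1 ler_wsqrtr.
Qed.

(** From cos (2 j t) = 1 - 2 sin^2 (j t) and |sin (j t)| <= j |sin t|, where v = cos^2 t. *)
Lemma cos2_poly_ge j v : 0 <= v <= 1 ->
  1 - 2 * j%:R ^+ 2 * (1 - v) <= (cos2_poly j).[v].
Proof.
move=> v01; have [t vE] := cos_sq_surj v01.
rewrite -vE horner_cos2_poly (_ : j%:R * (2 * t) = 2 * (j%:R * t)) ?cos_double -?sin2cos2; last by ring.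
have h : sin (j%:R * t) ^+ 2 <= j%:R ^+ 2 * sin t ^+ 2.
  rewrite -exprMn -[leLHS]real_normK ?num_real// -[leRHS]real_normK ?num_real//.
  by rewrite ler_sqr ?nnegrE// normrM [`|j%:R|]ger0_norm// sin_natmul_le.
by rewrite cos2sin2; nra.
Qed.

(** The Dirichlet kernel has the value 2 d + 1 at 1, so this one has the value 1 there. *)
Definition peak_poly d : {poly R} := d.*2.+1%:R^-1 *: dirichlet_poly d.

(** For v = cos^2 t the left side is sin^2 ((2 d + 1) t) / (2 d + 1)^2. *)
Lemma peak_poly_decay d v : 0 <= v <= 1 ->
  (1 - v) * (peak_poly d).[v] ^+ 2 <= d.*2.+1%:R ^- 2.
Proof.
move=> v01; have [t vE] := cos_sq_surj v01.
rewrite -vE -sin2cos2 /peak_poly hornerZ exprMn mulrCA -exprMn [sin t * _]mulrC.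
by rewrite horner_dirichlet_poly exprVn ler_piMr ?invr_ge0 ?exprn_ge0// sin2cos2 gerBl sqr_ge0.
Qed.

Lemma peak_poly_ge d v : 0 <= v <= 1 -> 1 - v <= d.*2.+1%:R ^- 2 ->
  2^-1 <= (peak_poly d).[v].
Proof.
move=> v01 vd; have N0 : 0 < d.*2.+1%:R :> R by rewrite ltr0n.
have d0 : 0 <= d%:R :> R by [].
have NE : d.*2.+1%:R = 2 * d%:R + 1 :> R by rewrite -muln2 -natr1 natrM; ring.
rewrite /peak_poly hornerZ -ler_pdivrMl ?invr_gt0// invrK.
rewrite /dirichlet_poly hornerD hornerE horner_sum.
have h (j : 'I_d) : true ->
    2 - 4 * d%:R ^+ 2 * (1 - v) <= (2 *: cos2_poly j.+1).[v].
  move=> _; have := cos2_poly_ge j.+1 v01; rewrite hornerZ.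
  have jd : j.+1%:R ^+ 2 <= d%:R ^+ 2 :> R.
    by rewrite ler_sqr ?nnegrE// ler_nat.
  have /andP[_ v1] := v01.
  have : 0 <= (d%:R ^+ 2 - j.+1%:R ^+ 2) * (1 - v) by rewrite mulr_ge0// subr_ge0.
  by rewrite mulrBl; lra.
have {}h : (2 - 4 * d%:R ^+ 2 * (1 - v)) * d%:R <=
    \sum_(i < d) (2 *: cos2_poly i.+1).[v].
  rewrite mulr_natr -[X in _ *+ X]card_ord -sumr_const.
  by apply: ler_sum => i _; exact: h.
apply: (le_trans _ (lerD (lexx _) h)).
(* After inserting 1 - v <= (2 d + 1)^-2 this is 8 d^3 <= (2 d + 1)^3. *)
have : 4 * d%:R ^+ 2 * (1 - v) * d%:R <= (2 * d%:R + 1) / 2.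
  have : 4 * d%:R ^+ 2 * (1 - v) * d%:R <= 4 * d%:R ^+ 2 * d%:R * (2 * d%:R + 1) ^- 2.
    rewrite -NE [leLHS]mulrAC ler_wpM2l// mulr_ge0// mulr_ge0// exprn_ge0//.
  move/le_trans; apply; rewrite ler_pdivrMr ?exprn_gt0 -?NE// NE.
  by nra.
rewrite NE; lra.
Qed.

(** Cauchy's formula for repeated integration, by parts. *)
Lemma horner_iter_antideriv k p : (iter k.+1 (@antideriv R) p).[1] =
  int01 ((1 - 'X) ^+ k * p) / k`!%:R.
Proof.
elim: k p => [|k IH] p; first by rewrite expr0 mul1r fact0 divr1.
rewrite iterSr IH.
have := int01_by_parts (antideriv p) ((1 - 'X) ^+ k.+1).
rewrite deriv_antideriv antideriv_at0 mul0r.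
have -> : ((1 - 'X) ^+ k.+1 : {poly R}).[1] = 0.
  by rewrite horner_exp !hornerE subrr expr0n.
rewrite mulr0 subrr sub0r deriv_exp derivB derivX derivC sub0r mulN1r /=.
rewrite [p * _]mulrC => ->.
rewrite (_ : - _ *+ _ = (- k.+1%:R) *: (1 - 'X) ^+ k); last first.
  by rewrite scaleNr scaler_nat mulNrn.
rewrite [antideriv p * _]mulrC int01Zl [- k.+1%:R * _]mulNr opprK factS natrM.
by rewrite invfM mulrACA divff ?mul1r// pnatr_eq0.
Qed.

Lemma iter_antideriv_ge0 k p : (forall x, 0 <= x <= 1 -> 0 <= p.[x]) ->
  forall x, 0 <= x <= 1 -> 0 <= (iter k (@antideriv R) p).[x].
Proof. by elim: k => // k IH p0 x x01; rewrite iterS antideriv_ge0// => *; exact: IH. Qed.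

Lemma size_iter_antideriv k p : (size (iter k (@antideriv R) p) <= size p + k)%N.
Proof.
elim: k => [|k IH]; first by rewrite addn0.
by rewrite iterS (leq_trans (size_antideriv _))// addnS ltnS.
Qed.

Lemma derivn_iter_antideriv r k p : (r <= k)%N ->
  (iter k (@antideriv R) p)^`(r) = iter (k - r) (@antideriv R) p.
Proof.
elim: r => [|r IH] rk; first by rewrite subn0 derivn0.
by rewrite derivnS IH 1?ltnW// -(subnSK rk) iterS deriv_antideriv.
Qed.

(** * Concentration of the Jackson-type kernel near 1 *)

Section PeakPower.
Variables d k : nat.
Let a : R := d.*2.+1%:R ^- 2.
(** With the exponent 2 (k + 3), [peak_poly_decay] bounds (1 - v)^(k + 3) p(v) by a^(k + 3), two
    powers beyond the moment of order k + 1 to be estimated. *)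
Let p : {poly R} := peak_poly d ^+ (k.+3).*2.
Let a0 : 0 < a. Proof. by rewrite invr_gt0 exprn_gt0// ltr0n. Qed.
Let a1 : a <= 1.
Proof. by rewrite invf_le1 ?exprn_gt0 ?ltr0n// exprn_ege1// ler1n. Qed.

Lemma peak_power_ge0 v : 0 <= p.[v].
Proof. by rewrite /p horner_exp -mul2n exprM exprn_ge0// sqr_ge0. Qed.

(** If 1 - v <= a, one factor 1 - v is replaced by a. Otherwise the decay of the kernel applies
    together with 1 - v + a <= 2 (1 - v); the second term is shaped to have an elementary
    antiderivative. *)
Lemma peak_power_ptwise v : 0 <= v <= 1 ->
  (1 - v) ^+ k.+1 * p.[v] <=
  a * ((1 - v) ^+ k * p.[v]) + 4 * a ^+ k.+3 / (1 - v + a) ^+ 2.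
Proof.
move=> v01; have /andP[v0 v1] := v01; have w0 : 0 <= 1 - v by rewrite subr_ge0.
have p0 := peak_power_ge0 v.
have wp0 : 0 <= (1 - v) ^+ k * p.[v] by rewrite mulr_ge0// exprn_ge0.
have t0 : 0 <= 4 * a ^+ k.+3 / (1 - v + a) ^+ 2.
  by apply: divr_ge0; [apply: mulr_ge0 => //; exact/exprn_ge0/ltW|exact: sqr_ge0].
case: (leP (1 - v) a) => [wa|aw].
  by rewrite exprS -mulrA ler_wpDr// ler_wpM2r.
apply: ler_wpDl; first by rewrite mulr_ge0// ltW.
have w1 : 0 < 1 - v by exact: lt_trans aw.
have h : (1 - v) ^+ k.+3 * p.[v] <= a ^+ k.+3.
  rewrite /p horner_exp -mul2n exprM -exprMn.
  apply: lerXn2r; rewrite ?nnegrE ?(ltW a0)//; last exact: peak_poly_decay.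
  by rewrite mulr_ge0// sqr_ge0.
have wa0 : 0 < 1 - v + a by rewrite ltr_wpDl.
rewrite ler_pdivlMr ?exprn_gt0//.
have h2 : (1 - v + a) ^+ 2 <= 4 * (1 - v) ^+ 2.
  have -> : 4 * (1 - v) ^+ 2 = (2 * (1 - v)) ^+ 2 by ring.
  by rewrite ler_sqr ?nnegrE ?mulr_ge0 ?(ltW wa0)//; lra.
apply: (@le_trans _ _ ((1 - v) ^+ k.+1 * p.[v] * (4 * (1 - v) ^+ 2))).
  by rewrite ler_wpM2l// mulr_ge0// exprn_ge0.
have -> : (1 - v) ^+ k.+1 * p.[v] * (4 * (1 - v) ^+ 2) = 4 * ((1 - v) ^+ k.+3 * p.[v]).
  by rewrite -(addn2 k.+1) exprD; ring.
by rewrite ler_wpM2l.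
Qed.

(** Integrates [peak_power_ptwise]: the antiderivative 4 a^(k + 3) / (1 - v + a) equals 4 a^(k + 2)
    at v = 1 and is nonnegative at v = 0. *)
Lemma int01_peak_power_le : int01 ((1 - 'X) ^+ k.+1 * p) <=
  a * int01 ((1 - 'X) ^+ k * p) + 4 * a ^+ k.+2.
Proof.
pose F1 := antideriv ((1 - 'X) ^+ k.+1 * p).
pose F0 := antideriv ((1 - 'X) ^+ k * p).
pose P := a *: F0 - F1.
have hx v : ((1 - 'X) ^+ k : {poly R}).[v] = (1 - v) ^+ k by rewrite horner_exp !hornerE.
have hx1 v : ((1 - 'X) ^+ k.+1 : {poly R}).[v] = (1 - v) ^+ k.+1 by rewrite horner_exp !hornerE.
have := @le_of_derive_ge0 R (fun v => P.[v] + 4 * a ^+ k.+3 * (1 - v + a)^-1)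
  (fun v => P^`().[v] + 4 * a ^+ k.+3 * (1 - v + a) ^- 2) 0 1 ler01.
have -> : P.[0] = 0 by rewrite /P !hornerE /F0 /F1 !antideriv_at0; ring.
rewrite add0r subrr add0r subr0 => h.
have {}h : 4 * a ^+ k.+3 / (1 + a) <= P.[1] + 4 * a ^+ k.+3 / a.
  apply: h => v /andP[v0 v1]; last first.
    have := peak_power_ptwise; move=> /(_ v); rewrite v0 v1 => /(_ isT).
    by rewrite /P derivB derivZ !deriv_antideriv hornerD hornerN hornerZ !hornerM hx hx1; lra.
  have c0 : 1 - v + a != 0 by rewrite lt0r_neq0// ltr_wpDl// subr_ge0.
  have d1 : is_derive v 1 (horner ((1 + a)%:P - 'X)) (-1).
    apply: (is_derive_eq (is_derive_poly _ _)).
    by rewrite derivB derivC derivX sub0r hornerN hornerE.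
  have hE y : ((1 + a)%:P - 'X).[y] = 1 - y + a.
    by rewrite hornerD hornerN hornerC hornerX addrAC.
  have c1 : ((1 + a)%:P - 'X).[v] != 0 by rewrite hE.
  have d2 := is_deriveV c1 d1.
  have d3 := is_deriveD (is_derive_poly P v) (is_deriveZ (4 * a ^+ k.+3) d2).
  rewrite (_ : (fun _ => _) = horner P + (4 * a ^+ k.+3) \*:
    (fun y => (horner ((1 + a)%:P - 'X) y)^-1)); last first.
    by apply/funext => y; rewrite -hE.
  apply: (is_derive_eq d3); rewrite /GRing.scale/=.
  by rewrite hE mulrN1 opprK.
have : 0 <= 4 * a ^+ k.+3 / (1 + a).
  apply: divr_ge0; last by rewrite addr_ge0// ltW.
  by apply: mulr_ge0 => //; exact/exprn_ge0/ltW.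
move/le_trans => /(_ _ h).
have -> : 4 * a ^+ k.+3 / a = 4 * a ^+ k.+2.
  by rewrite exprSr mulrA mulfK// lt0r_neq0.
by rewrite /P /int01 -/F0 -/F1 !hornerE; lra.
Qed.

(** On [1 - a, 1] the kernel is at least 4^-(k + 3) by [peak_poly_ge], and (1 - v)^k integrates
    there to a^(k + 1) / (k + 1). *)
Lemma int01_peak_power_ge :
  a ^+ k.+1 <= 4 ^+ k.+3 * k.+1%:R * int01 ((1 - 'X) ^+ k * p).
Proof.
pose F0 := antideriv ((1 - 'X) ^+ k * p).
pose c : R := (4 ^+ k.+3 * k.+1%:R)^-1.
pose P := F0 + c *: (1 - 'X) ^+ k.+1.
have hx v : ((1 - 'X) ^+ k : {poly R}).[v] = (1 - v) ^+ k by rewrite horner_exp !hornerE.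
have hx1 v : ((1 - 'X) ^+ k.+1 : {poly R}).[v] = (1 - v) ^+ k.+1 by rewrite horner_exp !hornerE.
have c0 : 0 < c by rewrite invr_gt0 mulr_gt0 ?exprn_gt0 ?ltr0n.
have a01 : 0 <= 1 - a <= 1 by rewrite subr_ge0 a1 lerBlDr lerDl ltW.
have ha : 1 - a <= 1 by have /andP[] := a01.
have : P.[1 - a] <= P.[1].
  apply: horner_le => // v /andP[v0 v1].
  have v01 : 0 <= v <= 1 by rewrite v1 (le_trans _ v0)//; have /andP[] := a01.
  rewrite /P derivD deriv_antideriv derivZ deriv_exp derivB derivX derivC sub0r mulN1r /=.
  rewrite hornerD hornerM hx hornerZ hornerMn hornerN hx.
  have wk : 0 <= (1 - v) ^+ k by rewrite exprn_ge0// subr_ge0.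
  have hp : (4 ^+ k.+3)^-1 <= p.[v].
    rewrite /p horner_exp -mul2n exprM -exprVn lerXn2r ?nnegrE ?invr_ge0 ?sqr_ge0//.
    have va : 1 - v <= a by lra.
    have := peak_poly_ge v01 va => hh.
    by have -> : 4^-1 = (2^-1) ^+ 2 :> R; [rewrite exprVn -natrX|rewrite ler_sqr ?nnegrE ?invr_ge0 ?(le_trans _ hh) ?invr_ge0].
  have -> : (1 - v) ^+ k * p.[v] + c * (- (1 - v) ^+ k *+ k.+1) =
    (1 - v) ^+ k * (p.[v] - (4 ^+ k.+3)^-1).
    rewrite /c -[- _ *+ _]mulr_natr.
    have : 4 ^+ k.+3 != 0 :> R by rewrite expf_neq0// pnatr_eq0.
    have : k.+1%:R != 0 :> R by rewrite pnatr_eq0.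
    by move: (4 ^+ k.+3 : R) (k.+1%:R : R) => u w w0 u0; field; rewrite u0 w0.
  by rewrite mulr_ge0// subr_ge0.
rewrite /P !hornerD !hornerZ !hx1 subrr expr0n /= mulr0 addr0 subKr => h.
rewrite -ler_pdivrMl; last by rewrite mulr_gt0 ?exprn_gt0 ?ltr0n.
apply: le_trans h; rewrite -[leLHS]add0r lerD//; apply: antideriv_ge0 => // v /andP[v0 v1].
by rewrite hornerM hx mulr_ge0 ?exprn_ge0 ?subr_ge0// peak_power_ge0.
Qed.

End PeakPower.

(** The factor [9 * q.+4%:R ^+ 2] bounds n^2 / (2 d + 1)^2 for the [d] chosen in [mix_poly_exists];
    the last factor comes from the ratio of consecutive moments of the kernel. *)
Definition mix_const (q : nat) : R := 9 * q.+4%:R ^+ 2 * (1 + 4 ^+ (q + 5)).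

Lemma mix_const_ge0 q : 0 <= mix_const q.
Proof.
apply: mulr_ge0; first by rewrite mulr_ge0// sqr_ge0.
by rewrite addr_ge0// exprn_ge0.
Qed.

Lemma mix_poly_exists q n : (0 < n)%N -> exists H : {poly R},
  [/\ (size H <= n.+1)%N, H`_0 = 0, H.[1] = 1,
      forall r x, (r <= q.+2)%N -> 0 <= x <= 1 -> 0 <= H^`(r).[x] &
      int01 H <= mix_const q / n%:R ^+ 2].
Proof.
move=> n0; have n0R : 0 < n%:R :> R by rewrite ltr0n.
have e4 : 0 <= 4 ^+ (q + 5) :> R by rewrite exprn_ge0.
(* For n < q + 2 there is no room for q + 2 integrations, but n is bounded in terms of q and ['X]
   suffices. *)
case: (ltnP n q.+2) => nq.
  exists 'X; split; rewrite ?size_polyX ?coefX ?hornerX//.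
    move=> [|[|r]] x _ /andP[x0 x1]; rewrite ?derivn0 ?hornerX// ?derivn1 ?derivX ?hornerE//.
    by rewrite derivn_poly0 ?size_polyX// horner0.
  rewrite ler_pdivlMr ?exprn_gt0//.
  have -> : int01 'X = 2^-1 :> R.
    rewrite (@int01_coefS _ _ 1) ?coefX ?size_polyX// big_ord_recl big_ord0 addr0.
    by rewrite coefX div1r.
  have nq' : n%:R ^+ 2 <= q.+4%:R ^+ 2 :> R by rewrite ler_sqr ?nnegrE// ler_nat; lia.
  rewrite /mix_const; have := sqr_ge0 (q.+4%:R : R); move: (q.+4%:R ^+ 2 : R) nq' => u nq' u0.
  by nra.
(* The largest [d] with 2 d (q + 4) + q + 2 <= n, the left side being the degree bound for [J]. *)
pose d := ((n - q.+2) %/ (q.+4).*2)%N.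
pose p := peak_poly d ^+ (q.+4).*2.
pose J := iter q.+2 (@antideriv R) p.
pose I0 := int01 ((1 - 'X) ^+ q.+1 * p); pose I1 := int01 ((1 - 'X) ^+ q.+2 * p).
have J1 : J.[1] = I0 / q.+1`!%:R by exact: horner_iter_antideriv.
have IJ : int01 J = I1 / q.+2`!%:R by rewrite -horner_iter_antideriv.
have hge := int01_peak_power_ge d q.+1; rewrite -/p -/I0 in hge.
have hle := int01_peak_power_le d q.+1; rewrite -/p -/I0 -/I1 in hle.
set a : R := d.*2.+1%:R ^- 2 in hge hle.
have a0 : 0 < a by rewrite invr_gt0 exprn_gt0// ltr0n.
have I0p : 0 < I0.
  have := lt_le_trans (exprn_gt0 q.+2 a0) hge.
  by rewrite pmulr_rgt0// mulr_gt0 ?exprn_gt0 ?ltr0n.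
have f0 m : 0 < m`!%:R :> R by rewrite ltr0n fact_gt0.
have J1p : 0 < J.[1] by rewrite J1 divr_gt0.
exists (J.[1]^-1 *: J); split.
- rewrite (leq_trans (size_scale_leq _ _))// (leq_trans (size_iter_antideriv _ _))//.
  have : (size p <= (d * (q.+4).*2).+1)%N.
    rewrite (leq_trans (size_poly_exp_leq _ _))// ltnS leq_mul2r.
    have : (size (peak_poly d) <= d.+1)%N.
      by rewrite (leq_trans (size_scale_leq _ _))// size_dirichlet_poly.
    by move=> ?; apply/orP; right; lia.
  have := leq_trunc_div (n - q.+2) (q.+4).*2; rewrite -/d; lia.
- by rewrite coefZ /J iterS coef_antideriv invr0 !mulr0.
- by rewrite hornerZ mulVf// lt0r_neq0.
- move=> r x rq x01; rewrite derivnZ hornerZ mulr_ge0 ?invr_ge0 ?(ltW J1p)//.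
  rewrite derivn_iter_antideriv// iter_antideriv_ge0// => v _.
  exact: peak_power_ge0.
have b1 : I1 <= a * I0 * (1 + 4 ^+ (q + 5) * q.+2%:R).
  apply: (le_trans hle); rewrite mulrDr mulr1 lerD2l [a ^+ _]exprS.
  rewrite mulrCA -[leRHS]mulrA ler_wpM2l ?(ltW a0)//.
  apply: (le_trans (ler_wpM2l _ hge)) => //.
  rewrite (_ : 4 * _ = I0 * (4 ^+ (q + 5) * q.+2%:R))//.
  by rewrite (addnS q 4) addn4 [_ ^+ q.+4.+1]exprS; ring.
(* The quotient of the two factorials is 1 / (q + 2), which absorbs the factor q + 2 of [b1]. *)
have IH : int01 (J.[1]^-1 *: J) <= a * (1 + 4 ^+ (q + 5)).
  rewrite int01Z IJ ler_pdivrMl// J1.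
  have q0 : 0 < q.+2%:R :> R by rewrite ltr0n.
  have -> : I0 / q.+1`!%:R * (a * (1 + 4 ^+ (q + 5))) =
    a * I0 * (1 + 4 ^+ (q + 5)) / q.+1`!%:R by ring.
  rewrite factS natrM invfM mulrA ler_wpM2r ?invr_ge0//.
  rewrite ler_pdivrMr//; apply: (le_trans b1).
  rewrite -[leRHS]mulrA ler_wpM2l ?mulr_ge0 ?(ltW a0) ?(ltW I0p)//.
  by rewrite mulrDl mul1r lerD2r ler1n.
apply: (le_trans IH); rewrite /mix_const mulrAC ler_wpM2r ?addr_ge0//.
have hd : (n <= 3 * q.+4 * d.*2.+1)%N.
  have := divn_eq (n - q.+2) (q.+4).*2; rewrite -/d.
  have := ltn_pmod (n - q.+2) (isT : 0 < (q.+4).*2)%N.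
  nia.
rewrite ler_pdivlMr ?exprn_gt0// /a mulrC ler_pdivrMr ?exprn_gt0 ?ltr0n//.
have -> : 9 = 3 ^+ 2 :> R by rewrite -natrX.
rewrite -!exprMn ler_sqr ?nnegrE ?mulr_ge0//.
by rewrite -!natrM ler_nat.
Qed.

End KernelPolynomial.

(** * Approximate convexity and the pointwise estimate *)

Section PowerInequalities.
Variable R : realType.
Implicit Types a e u v x y : R.

(** With s = ln y, the bound 1 + t <= exp t gives y^a (1 + (1 - a) s) <= y and y^a (1 - a s) <= 1.
    In their mean with weights a and 1 - a the terms in s cancel. *)
Lemma powR_le_tangent a y : 0 <= a <= 1 -> 0 <= y -> y `^ a <= 1 + a * (y - 1).
Proof.
move=> /andP[a0 a1]; rewrite le_eqVlt => /predU1P[<-|y0].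
  case: (eqVneq a 0) => [->|an0]; first by rewrite powRr0; lra.
  by rewrite powR0//; lra.
rewrite /powR gt_eqF//; set s := ln y.
have yE : y = expR s by rewrite /s lnK.
have e0 : 0 < expR (a * s) := expR_gt0 _.
have h1 : expR (a * s) * (1 + (1 - a) * s) <= y.
  rewrite yE [X in _ <= expR X](_ : s = a * s + (1 - a) * s) ?expRD; last by ring.
  by rewrite ler_wpM2l ?(ltW e0)// expR_ge1Dx.
have h2 : expR (a * s) * (1 - a * s) <= 1.
  rewrite -[X in _ <= X](expRxMexpNx_1 (a * s)).
  by rewrite ler_wpM2l ?(ltW e0)// expR_ge1Dx.
have {}h1 := ler_wpM2l a0 h1.
have a1' : 0 <= 1 - a by rewrite subr_ge0.
have {}h2 := ler_wpM2l a1' h2.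
by have := lerD h1 h2; lra.
Qed.

(** Write v^e = v / v^(1 - e) and bound the denominator by its tangent; what remains is a polynomial
    inequality. *)
Lemma powR_ge_parabola e v : 0 <= e <= 1 -> 0 <= v ->
  1 + e * (v - 1) - (v - 1) ^+ 2 <= v `^ e.
Proof.
move=> /andP[e0 e1]; rewrite le_eqVlt => /predU1P[<-|v0].
  by apply: le_trans (powR_ge0 _ _); lra.
have e1' : 0 <= 1 - e <= 1 by lra.
have h := powR_le_tangent e1' (ltW v0); set D := 1 + (1 - e) * (v - 1) in h.
have D0 : 0 < D by apply: lt_le_trans h; exact: powR_gt0.
have p0 : 0 < v `^ e by exact: powR_gt0.
have vE : v `^ e * v `^ (1 - e) = v.
  rewrite -powRD; last by apply/implyP => _; rewrite gt_eqF.
  by rewrite (_ : e + (1 - e) = 1) ?powRr1 ?(ltW v0)//; ring.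
have h1 : v <= v `^ e * D by rewrite -[X in X <= _]vE ler_wpM2l// ltW.
rewrite -(ler_pM2r D0); apply: le_trans h1; rewrite /D.
rewrite -subr_ge0 (_ : _ - _ = (v - 1) ^+ 2 * (e ^+ 2 + (1 - e) * v)); last by ring.
by rewrite mulr_ge0 ?sqr_ge0// addr_ge0 ?sqr_ge0// mulr_ge0 ?(ltW v0)//; lra.
Qed.

(** Square the sum: the squares have exponent 2 e <= 1 and the product is (1 - v^2)^e, so the
    tangent bound applies to all three and the linear terms cancel. *)
Lemma powR_symm_le e v : 0 <= e <= 2^-1 -> 0 <= v <= 1 ->
  (1 + v) `^ e + (1 - v) `^ e <= 2 - e / 2 * v ^+ 2.
Proof.
move=> /andP[e0 e1] /andP[v0 v1].
have v1' : 0 <= 1 - v by rewrite subr_ge0.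
have v2 : 0 <= 1 + v by rewrite addr_ge0.
set p := (1 + v) `^ e; set q := (1 - v) `^ e.
have p0 : 0 <= p := powR_ge0 _ _.
have q0 : 0 <= q := powR_ge0 _ _.
have sq x : 0 <= x -> (x `^ e) ^+ 2 <= 1 + 2 * e * (x - 1).
  move=> x0; rewrite -powR_mulrn ?powR_ge0// -powRrM mulrC.
  by apply: powR_le_tangent => //; lra.
have hp := sq _ v2; have hq := sq _ v1'; rewrite -/p -/q in hp hq.
have hpq : p * q <= 1 - e * v ^+ 2.
  rewrite -powRM//; have -> : (1 + v) * (1 - v) = 1 - v ^+ 2 by ring.
  have : 0 <= 1 - v ^+ 2 by nra.
  have e01 : 0 <= e <= 1 by lra.
  by move=> /(powR_le_tangent e01); lra.
have v21 : v ^+ 2 <= 1 by nra.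
have ev : 0 <= e / 2 * v ^+ 2 <= 4^-1 by have := sqr_ge0 v; nra.
have n2 : 0 <= 2 - e / 2 * v ^+ 2 by lra.
rewrite -ler_sqr ?nnegrE ?(addr_ge0 p0 q0)//.
have : 0 <= (e / 2 * v ^+ 2) ^+ 2 := sqr_ge0 _.
by nra.
Qed.

Lemma powR_tangent_err e x u : 0 <= e <= 1 -> 0 < x -> 0 <= u ->
  x `^ e - u `^ e + e * x `^ e / x * (u - x) <= x `^ e / x ^+ 2 * (u - x) ^+ 2.
Proof.
move=> e01 x0 u0; have vx : 0 <= u / x by rewrite divr_ge0// ltW.
have h := powR_ge_parabola e01 vx.
have uE : u `^ e = x `^ e * (u / x) `^ e.
  by rewrite -powRM ?(ltW x0)// mulrC divfK// gt_eqF.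
have p0 : 0 < x `^ e := powR_gt0 _ x0.
rewrite uE; have {}h := ler_wpM2l (ltW p0) h.
have xn : x != 0 by rewrite gt_eqF.
have e1 : e * x `^ e / x * (u - x) = x `^ e * (e * (u / x - 1)) by field.
have e2 : x `^ e / x ^+ 2 * (u - x) ^+ 2 = x `^ e * (u / x - 1) ^+ 2 by field.
by rewrite e1 e2; lra.
Qed.

Lemma powR_symm_diff_le (e z h : R) : 0 <= e <= 2^-1 -> 0 < z -> 0 <= h <= z ->
  (z + h) `^ e + (z - h) `^ e <= 2 * z `^ e - e / 2 * (z `^ e / z ^+ 2) * h ^+ 2.
Proof.
move=> e01 z0 /andP[h0 hz].
have v01 : 0 <= h / z <= 1 by rewrite divr_ge0 ?(ltW z0)//= ler_pdivrMr// mul1r.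
have /andP[v0 v1] := v01; have zn : z != 0 by rewrite gt_eqF.
have h1 := powR_symm_le e01 v01.
have -> : z + h = z * (1 + h / z) by field.
have -> : z - h = z * (1 - h / z) by field.
rewrite !powRM ?(ltW z0) ?subr_ge0 ?addr_ge0// -mulrDr.
apply: (le_trans (ler_wpM2l (powR_ge0 _ _) h1)).
by move: (z `^ e) => p; rewrite -subr_ge0 le_eqVlt; apply/orP/or_introl/eqP; field.
Qed.

Lemma continuous_powR01 e : 0 < e -> C01 (fun u => u `^ e).
Proof.
move=> e0; apply/continuous_within_itvP => //; split.
- move=> u; rewrite in_itv/= => /andP[u0 _].
  apply: differentiable_continuous; apply/derivable1_diffP.
  by apply: derivable_powR; rewrite in_itv/= u0.
- rewrite powR0 ?gt_eqF//; exact: powR_cvg0.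
suff h : {for (1 : R), continuous (fun u => u `^ e)} by apply: cvg_at_left_filter; exact: h.
apply: differentiable_continuous; apply/derivable1_diffP.
by apply: derivable_powR; rewrite in_itv/= ltr01.
Qed.

Lemma continuous_powR01_refl e : 0 < e -> C01 (fun u => (1 - u) `^ e).
Proof.
move=> e0; have cs u : {for u, continuous (fun w : R => 1 - w)}.
  by apply: cvgB; [exact: cvg_cst|exact: cvg_id].
apply/continuous_within_itvP => //; split.
- move=> u; rewrite in_itv/= => /andP[_ u1].
  apply: (@continuous_comp _ _ _ (fun w : R => 1 - w) (fun w => w `^ e)); first exact: cs.
  apply: differentiable_continuous; apply/derivable1_diffP.
  by apply: derivable_powR; rewrite in_itv/= subr_gt0 u1.
- apply: cvg_at_right_filter.
  apply: (@continuous_comp _ _ _ (fun w : R => 1 - w) (fun w => w `^ e)); first exact: cs.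
  apply: differentiable_continuous; apply/derivable1_diffP.
  by apply: derivable_powR; rewrite in_itv/= subr0 ltr01.
rewrite subrr powR0 ?gt_eqF//.
apply: (@decreasing_cvg_at_left_comp _ (fun w : R => 1 - w) (fun w => w `^ e) (BLeft 0) 1).
- by rewrite bnd_simp.
- by move=> u v _ _ uv; rewrite ltrD2l ltrN2.
- by apply: cvg_at_left_filter; exact: cs.
by rewrite subrr; exact: powR_cvg0.
Qed.

End PowerInequalities.

(** * A discrete maximum principle and Jensen's inequality with an error *)

Section ApproximateConvexity.
Variable R : realType.
Implicit Types (f F G Psi eta : R -> R) (a b x y w : R).

(** At an interior maximum point c the second difference with step [eta c] cannot be positive, so
    that step leaves [a, b]. Stepping by the distance to the nearer end, where [G] vanishes, then
    gives - w <= - G c. *)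
Lemma approx_max_principle G eta a b w : a <= b -> 0 <= w ->
  {within `[a, b], continuous G} -> G a = 0 -> G b = 0 ->
  (forall z, a < z < b -> 0 < eta z) ->
  (forall z h, a < z < b -> 0 < h <= eta z -> a <= z - h -> z + h <= b ->
     - w <= G (z - h) + G (z + h) - 2 * G z) ->
  (forall z, a < z < b -> a <= z - eta z -> z + eta z <= b ->
     0 < G (z - eta z) + G (z + eta z) - 2 * G z) ->
  forall z, a <= z <= b -> G z <= w.
Proof.
move=> ab w0 cG Ga Gb eta0 Gsmall Gbig z zab.
have [c] := EVT_max ab cG; rewrite in_itv/= => /andP[ac cb] Gc.
have Gc' t : a <= t <= b -> G t <= G c by move=> t01; apply: Gc; rewrite in_itv.
apply: (le_trans (Gc' _ zab)).
move: ac; rewrite le_eqVlt => /predU1P[<-|ac]; first by rewrite Ga.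
move: cb; rewrite le_eqVlt => /predU1P[->|cb]; first by rewrite Gb.
have cab : a < c < b by rewrite ac cb.
have e0 := eta0 _ cab.
case: (leP a (c - eta c)) => h1; case: (leP (c + eta c) b) => h2.
- have := Gbig _ cab h1 h2.
  have := Gc' (c - eta c); have := Gc' (c + eta c) => g1 g2.
  have := g1 ltac:(lra); have := g2 ltac:(lra); lra.
- have := Gsmall c (b - c) cab; have -> : c + (b - c) = b by ring.
  by rewrite Gb; move=> /(_ ltac:(lra) ltac:(lra) ltac:(lra)); have := Gc' (c - (b - c)) ltac:(lra); lra.
- have := Gsmall c (c - a) cab; have -> : c - (c - a) = a by ring.
  by rewrite Ga; move=> /(_ ltac:(lra) ltac:(lra) ltac:(lra)); have := Gc' (c + (c - a)) ltac:(lra); lra.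
case: (leP (c - a) (b - c)) => h3.
- have := Gsmall c (c - a) cab; have -> : c - (c - a) = a by ring.
  by rewrite Ga; move=> /(_ ltac:(lra) ltac:(lra) ltac:(lra)); have := Gc' (c + (c - a)) ltac:(lra); lra.
- have := Gsmall c (b - c) cab; have -> : c + (b - c) = b by ring.
  by rewrite Gb; move=> /(_ ltac:(lra) ltac:(lra) ltac:(lra)); have := Gc' (c - (b - c)) ltac:(lra); lra.
Qed.

Definition approx_convex_at w x F := forall y1 y2, 0 <= y1 -> y1 < x -> x < y2 ->
  y2 <= 1 -> (y2 - y1) * (F x - w) <= (y2 - x) * F y1 + (x - y1) * F y2.

(** The supremum [s] of the slopes from the left to the lowered point (x, F x - w) is the slope of a
    line through that point that lies below F; averaging it gives the claim. *)
Lemma approx_jensen (I : finType) (m y : I -> R) w x F : 0 < x < 1 -> 0 <= w ->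
  (forall i, 0 <= m i) -> (forall i, 0 <= y i <= 1) ->
  \sum_i m i = 1 -> \sum_i m i * y i = x ->
  approx_convex_at w x F -> F x - w <= \sum_i m i * F (y i).
Proof.
move=> /andP[x0 x1] w0 m0 y01 m1 mx Fc.
pose S := [set (F x - w - F u) / (x - u) | u in [set u | 0 <= u < x]].
have ub v : x < v -> v <= 1 -> ubound S ((F v - F x + w) / (v - x)).
  move=> xv v1 _ [u /andP[u0 ux] <-].
  rewrite ler_pdivrMr ?subr_gt0// mulrAC ler_pdivlMr ?subr_gt0//.
  by have := Fc u v u0 ux xv v1; lra.
have Sn : S !=set0 by exists ((F x - w - F 0) / (x - 0)), 0 => //=; rewrite lexx x0.
have Sb : has_ubound S by exists ((F 1 - F x + w) / (1 - x)); apply: ub.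
pose s := sup S.
have key u : 0 <= u <= 1 -> F x - w + s * (u - x) <= F u.
  move=> /andP[u0 u1]; case: (ltgtP u x) => [ux|xu|->]; last by rewrite subrr; lra.
    have : (F x - w - F u) / (x - u) <= s.
      by apply: ub_le_sup => //; exists u => //=; rewrite u0.
    by rewrite ler_pdivrMr ?subr_gt0//; lra.
  have : s <= (F u - F x + w) / (u - x) by apply: ge_sup => //; exact: ub.
  by rewrite ler_pdivlMr ?subr_gt0//; lra.
have : \sum_i m i * (F x - w + s * (y i - x)) <= \sum_i m i * F (y i).
  by apply: ler_sum => i _; rewrite ler_wpM2l// key.
apply: le_trans; rewrite (eq_bigr (fun i => (F x - w - s * x) * m i + s * (m i * y i))).
  by rewrite big_split/= -!mulr_sumr m1 mx; lra.
by move=> i _; ring.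
Qed.

(** The maximum principle for f + Psi minus its chord on [a, b] yields [approx_convex_at w x]: small
    steps lose at most w, and at the step [eta z] the gain from [Psi] exceeds w. *)
Lemma one_sided_estimate (I : finType) (m y : I -> R) w x f Psi eta :
  0 < x < 1 -> 0 <= w ->
  (forall i, 0 <= m i) -> (forall i, 0 <= y i <= 1) ->
  \sum_i m i = 1 -> \sum_i m i * y i = x ->
  C01 f -> C01 Psi ->
  (forall z, 0 < z < 1 -> 0 < eta z) ->
  (forall z h, 0 < z < 1 -> 0 < h <= eta z -> 0 <= z - h -> z + h <= 1 ->
     - w <= f (z - h) + f (z + h) - 2 * f z) ->
  (forall z h, 0 < z < 1 -> 0 < h -> 0 <= z - h -> z + h <= 1 ->
     0 <= Psi (z - h) + Psi (z + h) - 2 * Psi z) ->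
  (forall z, 0 < z < 1 -> 0 <= z - eta z -> z + eta z <= 1 ->
     w < Psi (z - eta z) + Psi (z + eta z) - 2 * Psi z) ->
  f x - \sum_i m i * f (y i) <= w + (\sum_i m i * Psi (y i) - Psi x).
Proof.
move=> x01 w0 m0 y01 m1 mx cf cPsi eta0 fs Pc Pb.
pose F u := f u + Psi u.
suff Fc : approx_convex_at w x F.
  have := approx_jensen x01 w0 m0 y01 m1 mx Fc.
  rewrite (eq_bigr (fun i => m i * f (y i) + m i * Psi (y i))); last by move=> i _; rewrite mulrDr.
  by rewrite big_split /F /=; lra.
move=> a b a0 ax xb b1; have ba : 0 < b - a by lra.
have ba0 : b - a != 0 by rewrite gt_eqF.
pose L u := F a + (F b - F a) / (b - a) * (u - a).
pose G u := F u - L u.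
have LL z h : L (z - h) + L (z + h) - 2 * L z = 0 by rewrite /L; ring.
have La : L a = F a by rewrite /L; ring.
have Lb : L b = F b by rewrite /L divfK//; ring.
have : G x <= w.
  apply: (@approx_max_principle G eta a b w) => //; rewrite ?/G ?La ?Lb ?subrr//.
  - lra.
  - suff c01 : {within `[0, 1], continuous (fun u => F u - L u)}.
      apply: continuous_subspaceW c01 => u /=.
      by rewrite !in_itv/= => /andP[? ?]; apply/andP; split; lra.
    move=> z; rewrite /F.
    apply: cvgB; first by apply: cvgD; [exact: cf|exact: cPsi].
    have cL : continuous L.
      move=> u; rewrite /L; apply: cvgD; first exact: cvg_cst.
      apply: cvgM; first exact: cvg_cst.
      by apply: cvgB; [exact: cvg_id|exact: cvg_cst].
    exact: (continuous_subspaceT cL).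
  - by move=> z /andP[az zb]; apply: eta0; lra.
  - move=> z h /andP[az zb] hh h1 h2; have /andP[h0 _] := hh.
    have z01 : 0 < z < 1 by lra.
    have := fs z h z01 hh ltac:(lra) ltac:(lra).
    have := Pc z h z01 h0 ltac:(lra) ltac:(lra).
    by have := LL z h; rewrite /F; lra.
  - move=> z /andP[az zb] h1 h2; have z01 : 0 < z < 1 by lra.
    have e0 := eta0 _ z01.
    have := fs z (eta z) z01 ltac:(rewrite lexx e0; exact: isT) ltac:(lra) ltac:(lra).
    have := Pb z z01 ltac:(lra) ltac:(lra).
    by have := LL z (eta z); rewrite /F; lra.
  - lra.
rewrite /G lerBlDr => h; have := ler_wpM2l (ltW ba) h.
have -> : (b - a) * (w + L x) = (b - a) * w + ((b - x) * F a + (x - a) * F b).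
  by rewrite /L; field.
lra.
Qed.

End ApproximateConvexity.

(** * The pointwise estimate for finite means *)

Section MeanEstimate.
Variable R : realType.

Lemma powR_halfD (a l : R) : 0 < a -> (a `^ (l / 2)) ^+ 2 = a `^ l.
Proof.
move=> a0; rewrite expr2 -powRD; last by apply/implyP => _; rewrite gt_eqF.
by congr (_ `^ _); field.
Qed.

Lemma powR_inv_sq (e z : R) : 0 < z -> z `^ e / z ^+ 2 = (z `^ (2 - e))^-1.
Proof.
move=> z0; rewrite powRB; last by apply/implyP => _; rewrite gt_eqF.
by rewrite powR_mulrn ?(ltW z0)// invf_div.
Qed.

Lemma invr_powR (a l : R) : 0 < a -> a^-1 `^ l = (a `^ l)^-1.
Proof. by move=> a0; rewrite -powR_inv1 ?ltW// -powRrM mulN1r powRN. Qed.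

Lemma phi_gt0 (x : R) : 0 < x < 1 -> 0 < phi x.
Proof. by move=> /andP[x0 x1]; rewrite sqrtr_gt0 mulr_gt0// subr_gt0. Qed.

Lemma phi_sq (x : R) : 0 <= x <= 1 -> phi x ^+ 2 = x * (1 - x).
Proof. by move=> /andP[x0 x1]; rewrite sqr_sqrtr// mulr_ge0// subr_ge0. Qed.

(* [local_step d l x] is the argument at which the modulus is evaluated, for d = 1 / n. *)
Definition local_step (d l x : R) : R :=
  d * phi x `^ (1 - l / 2) * (phi x + d) `^ (- (l / 2)).

(** In this form l is only the exponent of the ratio r of z (1 - z) to phi x (phi x + d). *)
Lemma local_step_sq (d l x z : R) : 0 < d -> 0 < x < 1 -> 0 < z < 1 ->
  (local_step d l x * phi z `^ l) ^+ 2 =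
  (d * phi x) ^+ 2 * (z * (1 - z) / (phi x * (phi x + d))) `^ l.
Proof.
move=> d0 x01 z01; have p0 := phi_gt0 x01; have q0 := phi_gt0 z01.
have pd0 : 0 < phi x + d by rewrite addr_gt0.
transitivity ((d * phi x) ^+ 2 *
    ((phi z `^ l) ^+ 2 / (phi x `^ l * (phi x + d) `^ l))).
  rewrite /local_step powRB; last by apply/implyP => _; rewrite gt_eqF.
  rewrite (powRr1 (ltW p0)) powRN -(powR_halfD l p0) -(powR_halfD l pd0).
  have := powR_gt0 (l / 2) p0; have := powR_gt0 (l / 2) pd0.
  move: (phi x `^ (l / 2)) ((phi x + d) `^ (l / 2)) (phi z `^ l) (phi x) => A B P q B0 A0.
  by field; rewrite !gt_eqF.
congr (_ * _); have /andP[z0 z1] := z01.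
have Z0 : 0 < z * (1 - z) by rewrite mulr_gt0// subr_gt0.
have W0 : 0 < phi x * (phi x + d) by rewrite mulr_gt0.
rewrite [(_ / (_ * _)) `^ l]powRM ?invr_ge0 ?(ltW Z0) ?(ltW W0)// invr_powR//.
rewrite [(phi x * _) `^ l]powRM ?(ltW p0) ?(ltW pd0)//; congr (_ / _).
by rewrite expr2 -powRM ?(ltW q0)// -expr2 phi_sq ?(ltW z0) ?(ltW z1).
Qed.

(** The first term suffices for r >= 1 and the second for r < 1; they stand for the quadratic and
    the power part of [test_fun]. *)
Lemma powR_ratio_ge (r l e : R) : 0 < r -> 0 <= l -> l <= 2 - e -> 
  1 <= r `^ l + r `^ l / r `^ (2 - e).
Proof.
move=> r0 l0 le; have p0 := powR_gt0 (2 - e) r0; have pl := powR_gt0 l r0.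
case: (leP 1 r) => r1.
  apply: ler_wpDr; first by rewrite divr_ge0// ltW.
  by rewrite -[X in X <= _](powRr0 r) ler_powR.
apply: ler_wpDl; first exact: ltW.
by rewrite ler_pdivlMr// mul1r ger_powR// r0 ltW.
Qed.

(** The smaller of z and 1 - z is at most 2 z (1 - z), and 2^s <= 4. *)
Lemma inv_powR_sum_ge (s z : R) : 0 <= s <= 2 -> 0 < z < 1 ->
  ((z * (1 - z)) `^ s)^-1 / 4 <= (z `^ s)^-1 + ((1 - z) `^ s)^-1.
Proof.
move=> /andP[s0 s2] /andP[z0 z1]; have z1' : 0 < 1 - z by rewrite subr_gt0.
have Z0 : 0 < z * (1 - z) by rewrite mulr_gt0.
have b (u : R) : 0 < u -> u <= 2 * (z * (1 - z)) -> ((z * (1 - z)) `^ s)^-1 / 4 <= (u `^ s)^-1.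
  move=> u0 uZ; rewrite -invfM lef_pV2 ?posrE ?mulr_gt0 ?powR_gt0//.
  have : u `^ s <= (2 * (z * (1 - z))) `^ s.
    by apply: ge0_ler_powR => //; rewrite nnegrE ?ltW// mulr_gt0.
  move/le_trans; apply; rewrite powRM ?(ltW Z0)// mulrC ler_wpM2l ?powR_ge0//.
  have -> : 4 = (2 : R) `^ 2%:R by rewrite powR_mulrn// -natrX.
  by rewrite ler_powR// ler1n.
case: (leP z 2^-1) => zh.
  by apply: ler_wpDr; [rewrite invr_ge0 powR_ge0|apply: b => //; nra].
by apply: ler_wpDl; [rewrite invr_ge0 powR_ge0|apply: b => //; nra].
Qed.

(** * The convex test function *)

Section TestFunction.
Variables (x d e : R).
Hypotheses (x01 : 0 < x < 1) (d0 : 0 < d) (e0 : 0 < e) (e1 : e <= 2^-1).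
Let D := (d * phi x) ^+ 2.
Let Y := phi x * (phi x + d).
Let b := Y `^ (2 - e) / D.
Let p0 : 0 < phi x. Proof. exact: phi_gt0. Qed.
Let D0 : 0 < D. Proof. by rewrite exprn_gt0// mulr_gt0. Qed.
Let Y0 : 0 < Y. Proof. by rewrite mulr_gt0// addr_gt0. Qed.
Let b0 : 0 < b. Proof. by rewrite divr_gt0// powR_gt0. Qed.

(** The quadratic part has large second differences where z (1 - z) >= Y, the power part near the
    end points. [b] is chosen so that both scale with the ratio of z (1 - z) to [Y]. *)
Definition test_fun (u : R) : R :=
  (u - x) ^+ 2 / D - b * (u `^ e + (1 - u) `^ e).

Lemma C01_test_fun : C01 test_fun.
Proof.
move=> z; rewrite /test_fun; apply: cvgB.
  have cL : continuous (fun u : R => (u - x) ^+ 2 / D).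
    move=> u; apply: cvgM; last exact: cvg_cst.
    rewrite expr2; under eq_fun do rewrite expr2.
    by apply: cvgM; apply: cvgB; [exact: cvg_id|exact: cvg_cst|exact: cvg_id|exact: cvg_cst].
  exact: (continuous_subspaceT cL).
apply: cvgM; first exact: cvg_cst.
by apply: cvgD; [exact: (continuous_powR01 e0)|exact: (continuous_powR01_refl e0)].
Qed.

Lemma test_fun_diff_ge (z h : R) : 0 < z < 1 -> 0 <= h -> 0 <= z - h -> z + h <= 1 ->
  2 * h ^+ 2 / D + b * (e / 2) * h ^+ 2 * ((z `^ (2 - e))^-1 + ((1 - z) `^ (2 - e))^-1) <=
  test_fun (z - h) + test_fun (z + h) - 2 * test_fun z.
Proof.
move=> /andP[z0 z1] h0 zh1 zh2; have z1' : 0 < 1 - z by rewrite subr_gt0.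
have e01 : 0 <= e <= 2^-1 by rewrite ltW.
have i1 := @powR_symm_diff_le _ e z h e01 z0 ltac:(lra).
have i2 := @powR_symm_diff_le _ e (1 - z) h e01 z1' ltac:(lra).
rewrite !powR_inv_sq// in i1 i2.
have {}i1 := ler_wpM2l (ltW b0) i1; have {}i2 := ler_wpM2l (ltW b0) i2.
rewrite /test_fun.
have -> : 1 - (z - h) = 1 - z + h by ring.
have -> : 1 - (z + h) = 1 - z - h by ring.
have -> : (z - h - x) ^+ 2 / D = (z - x) ^+ 2 / D - 2 * h * (z - x) / D + h ^+ 2 / D by ring.
have -> : (z + h - x) ^+ 2 / D = (z - x) ^+ 2 / D + 2 * h * (z - x) / D + h ^+ 2 / D by ring.
lra.
Qed.

Lemma test_fun_convex (z h : R) : 0 < z < 1 -> 0 <= h -> 0 <= z - h -> z + h <= 1 ->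
  0 <= test_fun (z - h) + test_fun (z + h) - 2 * test_fun z.
Proof.
move=> z01 h0 zh1 zh2; apply: le_trans (test_fun_diff_ge z01 h0 zh1 zh2).
rewrite addr_ge0 ?divr_ge0 ?mulr_ge0 ?sqr_ge0 ?addr_ge0 ?invr_ge0 ?powR_ge0// ?ltW//.
Qed.

(** With r = z (1 - z) / Y and h^2 = D r^l, [test_fun_diff_ge] becomes at least 2 r^l + (e / 8) r^l
    / r^(2 - e), to which [powR_ratio_ge] applies. *)
Lemma test_fun_diff_large (l z : R) : 0 <= l -> l <= 2 - e -> 0 < z < 1 ->
  let h := local_step d l x * phi z `^ l in 0 <= z - h -> z + h <= 1 ->
  e / 8 <= test_fun (z - h) + test_fun (z + h) - 2 * test_fun z.
Proof.
move=> l0 le z01 h zh1 zh2; have h0 : 0 <= h.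
  by rewrite !mulr_ge0 ?powR_ge0// ltW.
apply: le_trans (test_fun_diff_ge z01 h0 zh1 zh2).
have hE : h ^+ 2 = D * (z * (1 - z) / Y) `^ l by apply: local_step_sq.
have /andP[z0 z1] := z01; have Z0 : 0 < z * (1 - z) by rewrite mulr_gt0// subr_gt0.
have r0 : 0 < z * (1 - z) / Y by rewrite divr_gt0.
have h1 := powR_ratio_ge r0 l0 le.
have e0' := e0; have e1' := e1.
have s02 : 0 <= 2 - e <= 2 by lra.
have h2 := inv_powR_sum_ge s02 z01.
set r := z * (1 - z) / Y in hE r0 h1.
set S := _^-1 + _^-1 in h2 *.
have rl := powR_gt0 l r0.
have rs : (r `^ (2 - e))^-1 = Y `^ (2 - e) * ((z * (1 - z)) `^ (2 - e))^-1.
  rewrite /r powRM ?invr_ge0 ?(ltW Z0) ?(ltW Y0)// invr_powR//.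
  by rewrite invfM invrK mulrC.
have -> : 2 * h ^+ 2 / D + b * (e / 2) * h ^+ 2 * S =
  2 * r `^ l + e / 2 * (r `^ l * (Y `^ (2 - e) * S)).
  by rewrite hE /b; field; rewrite gt_eqF.
have h3 : (r `^ (2 - e))^-1 / 4 <= Y `^ (2 - e) * S.
  by rewrite rs -mulrA ler_wpM2l// powR_ge0.
have {}h3 := ler_wpM2l (ltW rl) h3.
have e8 : 0 <= e / 8 by lra.
have {}h1 := ler_wpM2l e8 h1.
have e2 : 0 <= e / 2 by lra.
have {}h3 := ler_wpM2l e2 h3.
have h4 : e / 8 * r `^ l <= 2 * r `^ l by rewrite ler_wpM2r ?(ltW rl)//; lra.
lra.
Qed.

Variables (I : finType) (m y : I -> R) (C : R).
Hypotheses (m0 : forall i, 0 <= m i) (y01 : forall i, 0 <= y i <= 1)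
  (m1 : \sum_i m i = 1) (mx : \sum_i m i * y i = x) (C1 : 1 <= C)
  (mV : \sum_i m i * (y i - x) ^+ 2 <= C * D).

(* Stated for a point [x'] and nodes [y'] in order to cover both [x, y] and
   their reflections [1 - x, 1 - y]. *)
Lemma mean_powR_err (x' : R) (y' : I -> R) : 0 < x' -> phi x ^+ 2 <= x' ->
  (forall i, 0 <= y' i) -> \sum_i m i * (y' i - x') = 0 ->
  \sum_i m i * (y' i - x') ^+ 2 <= C * D ->
  b * (x' `^ e - \sum_i m i * y' i `^ e) <= 4 * C.
Proof.
move=> x'0 px' y'0 my' mV'.
have e0' := e0; have e1' := e1; have C1' := C1.
have e01 : 0 <= e <= 1 by lra.
have s0 : 0 <= 2 - e by lra.
have s02 : 2 - e <= 2%:R by lra.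
have P0 : 0 < x' `^ e := powR_gt0 _ x'0.
(* Away from the end point the tangent error and the second moment give C (Y / x')^(2 - e), which is
   at most 4 C. *)
case: (leP (Y / 2) x') => hx.
  have h1 : x' `^ e - \sum_i m i * y' i `^ e <= x' `^ e / x' ^+ 2 * (C * D).
    apply: le_trans (ler_wpM2l _ mV'); last by rewrite divr_ge0 ?sqr_ge0 ?ltW.
    have : \sum_i m i * (x' `^ e - y' i `^ e + e * x' `^ e / x' * (y' i - x')) <=
           \sum_i m i * (x' `^ e / x' ^+ 2 * (y' i - x') ^+ 2).
      by apply: ler_sum => i _; rewrite ler_wpM2l// powR_tangent_err.
    rewrite (eq_bigr (fun i => x' `^ e * m i - m i * y' i `^ e +
      e * x' `^ e / x' * (m i * (y' i - x')))); last by move=> i _; ring.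
    rewrite big_split sumrB/= -!mulr_sumr m1 my' mulr0 mulr1 addr0.
    move/le_trans; apply; rewrite mulr_sumr le_eqVlt; apply/orP/or_introl/eqP.
    by apply: eq_bigr => i _; ring.
  apply: (le_trans (ler_wpM2l (ltW b0) h1)).
  rewrite powR_inv_sq//.
  have -> : b * ((x' `^ (2 - e))^-1 * (C * D)) = C * (Y `^ (2 - e) / x' `^ (2 - e)).
    rewrite /b; have := powR_gt0 (2 - e) x'0; move: (x' `^ (2 - e)) => q q0.
    by field; rewrite !gt_eqF.
  rewrite [4 * C]mulrC ler_wpM2l//; first by lra.
  rewrite ler_pdivrMr ?powR_gt0//.
  have : Y `^ (2 - e) <= (2 * x') `^ (2 - e).
    apply: ge0_ler_powR; rewrite ?nnegrE ?(ltW Y0)//.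
      by rewrite mulr_ge0// ltW.
    by move: hx; rewrite ler_pdivrMr// mulrC.
  move/le_trans; apply; rewrite powRM ?(ltW x'0)// ler_wpM2r ?powR_ge0//.
  have -> : 4 = (2 : R) `^ 2%:R by rewrite powR_mulrn// -natrX.
  by rewrite ler_powR// ler1n.
(* Near the end point the mean is discarded: b x'^e <= b Y^e = Y^2 / D, and phi x < d makes Y at
   most 2 d phi x. *)
have pd : phi x < d.
  have : phi x * phi x < phi x * ((phi x + d) / 2).
    by apply: le_lt_trans (le_trans _ px') _ => //; rewrite ?expr2// mulrA.
  by rewrite ltr_pM2l//; lra.
have Y2 : Y ^+ 2 <= 4 * D.
  have -> : 4 * D = (phi x * (2 * d)) ^+ 2 by rewrite /D; ring.
  by rewrite ler_sqr ?nnegrE ?(ltW Y0) ?mulr_ge0 ?(ltW p0) ?(ltW d0)// /Y ler_wpM2l ?(ltW p0)//; lra.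
have S0 : 0 <= \sum_i m i * y' i `^ e.
  by apply: sumr_ge0 => i _; rewrite mulr_ge0// powR_ge0.
have h1 : b * (x' `^ e - \sum_i m i * y' i `^ e) <= b * Y `^ e.
  rewrite ler_wpM2l ?(ltW b0)// lerBlDr ler_wpDr//.
  apply: ge0_ler_powR; rewrite ?nnegrE ?(ltW Y0) ?(ltW x'0) ?(ltW e0)//.
  apply: ltW; apply: lt_le_trans hx _.
  by rewrite ler_pdivrMr// ler_peMr ?(ltW Y0)// ler1n.
apply: (le_trans h1).
have -> : b * Y `^ e = Y ^+ 2 / D.
  rewrite /b mulrAC -powRD; last by apply/implyP => _; rewrite gt_eqF.
  by rewrite subrK powR_mulrn// ltW.
by rewrite ler_pdivrMr// (le_trans Y2)// ler_wpM2r ?(ltW D0)//; lra.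
Qed.

(** The quadratic part contributes C, and each of the two powers 4 C. *)
Lemma mean_test_fun_le : \sum_i m i * test_fun (y i) - test_fun x <= 9 * C.
Proof.
have C1' := C1; have /andP[x0 x1] := x01; have x1' : 0 < 1 - x by rewrite subr_gt0.
have px : phi x ^+ 2 = x * (1 - x) by rewrite phi_sq// !ltW.
have mx0 : \sum_i m i * (y i - x) = 0.
  rewrite (eq_bigr (fun i => m i * y i - x * m i)); last by move=> i _; ring.
  by rewrite sumrB -mulr_sumr m1 mx; ring.
have h1 := @mean_powR_err x y x0.
have h2 := @mean_powR_err (1 - x) (fun i => 1 - y i) x1'.
have {}h1 : b * (x `^ e - \sum_i m i * y i `^ e) <= 4 * C.
  by apply: h1 => //; [rewrite px; nra|move=> i; have /andP[] := y01 i].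
have {}h2 : b * ((1 - x) `^ e - \sum_i m i * (1 - y i) `^ e) <= 4 * C.
  apply: h2.
  - by rewrite px; nra.
  - by move=> i; rewrite subr_ge0; have /andP[] := y01 i.
  - rewrite (eq_bigr (fun i => - (m i * (y i - x)))); last by move=> i _; ring.
    by rewrite sumrN mx0 oppr0.
  - rewrite (eq_bigr (fun i => m i * (y i - x) ^+ 2))//.
    by move=> i _; ring.
rewrite (eq_bigr (fun i => m i * (y i - x) ^+ 2 / D -
  b * (m i * y i `^ e) - b * (m i * (1 - y i) `^ e))); last first.
  by move=> i _; rewrite /test_fun; ring.
rewrite !sumrB -!mulr_sumr -mulr_suml /test_fun subrr expr0n mul0r.
have : (\sum_i m i * (y i - x) ^+ 2) / D <= C by rewrite ler_pdivrMr.
lra.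
Qed.

End TestFunction.

(** Here 576 = 16 * 4 * 9, from [K = 16 / e * w], [e = (2 - l1) / 4] and the bound 9 C of
    [mean_test_fun_le]. *)
Definition estimate_const (C l1 : R) : R := 1 + 576 * C / (2 - l1).

Lemma estimate_const_gt0 (C l1 : R) : 0 <= C -> l1 < 2 -> 0 < estimate_const C l1.
Proof.
move=> C0 l12; apply: ltr_pwDl; first exact: ltr01.
apply: divr_ge0; first by apply: mulr_ge0; [exact: ler0n|exact: C0].
by rewrite subr_ge0 ltW.
Qed.

Lemma mean_estimate (I : finType) (m y : I -> R) (x d C l l1 w : R) (f : R -> R) :
  0 < x < 1 -> 0 < d -> 0 <= l <= l1 -> l1 < 2 -> 1 <= C -> 0 < w ->
  (forall i, 0 <= m i) -> (forall i, 0 <= y i <= 1) ->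
  \sum_i m i = 1 -> \sum_i m i * y i = x ->
  \sum_i m i * (y i - x) ^+ 2 <= C * (d * phi x) ^+ 2 ->
  C01 f ->
  (forall z h, 0 < z < 1 -> 0 < h <= local_step d l x * phi z `^ l ->
     0 <= z - h -> z + h <= 1 -> `|f (z - h) + f (z + h) - 2 * f z| <= w) ->
  `|f x - \sum_i m i * f (y i)| <= estimate_const C l1 * w.
Proof.
move=> x01 d0 /andP[l0 ll1] l12 C1 w0 m0 y01 m1 mx mV cf fw.
(* This ensures both e <= 1/2 and l <= 2 - e, and depends on l1 alone. *)
pose e : R := (2 - l1) / 4.
have e0 : 0 < e by rewrite /e; lra.
have e1 : e <= 2^-1 by rewrite /e; lra.
have le : l <= 2 - e by rewrite /e; lra.
(* Scales the lower bound e / 8 of [test_fun_diff_large] to 2 w, hence above w. *)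
pose K := 16 / e * w.
have K0 : 0 < K by rewrite !mulr_gt0// invr_gt0.
pose Psi u := K * test_fun x d e u.
have cPsi : C01 Psi.
  by move=> z; apply: cvgM; [exact: cvg_cst|exact: C01_test_fun].
have eta0 z : 0 < z < 1 -> 0 < local_step d l x * phi z `^ l.
  move=> z01; rewrite !mulr_gt0 ?powR_gt0 ?addr_gt0 ?phi_gt0//.
have dPsi z h : Psi (z - h) + Psi (z + h) - 2 * Psi z =
  K * (test_fun x d e (z - h) + test_fun x d e (z + h) - 2 * test_fun x d e z).
  by rewrite /Psi; ring.
have Pc z h : 0 < z < 1 -> 0 < h -> 0 <= z - h -> z + h <= 1 ->
     0 <= Psi (z - h) + Psi (z + h) - 2 * Psi z.
  by move=> z01 h0 h1 h2; rewrite dPsi mulr_ge0 ?(ltW K0)// test_fun_convex// ltW.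
have Pb z : 0 < z < 1 -> 0 <= z - local_step d l x * phi z `^ l ->
     z + local_step d l x * phi z `^ l <= 1 ->
     w < Psi (z - local_step d l x * phi z `^ l) + Psi (z + local_step d l x * phi z `^ l) - 2 * Psi z.
  move=> z01 h1 h2; rewrite dPsi.
  have := test_fun_diff_large x01 d0 e0 e1 l0 le z01 h1 h2.
  move/(ler_wpM2l (ltW K0)); apply: lt_le_trans.
  have -> : K * (e / 8) = 2 * w by rewrite /K; field; rewrite gt_eqF.
  lra.
have Merr : \sum_i m i * Psi (y i) - Psi x <= K * (9 * C).
  rewrite (eq_bigr (fun i => K * (m i * test_fun x d e (y i)))); last by move=> i _; rewrite /Psi; ring.
  rewrite -mulr_sumr -mulrBr ler_wpM2l ?(ltW K0)//.
  exact: mean_test_fun_le.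
have cE : estimate_const C l1 * w = w + K * (9 * C).
  rewrite /estimate_const.
  have -> : 2 - l1 = 4 * e by rewrite /e; field.
  by rewrite /K; field; rewrite gt_eqF.
have h1 : f x - \sum_i m i * f (y i) <= w + (\sum_i m i * Psi (y i) - Psi x).
  apply: (one_sided_estimate x01 (ltW w0) m0 y01 m1 mx cf cPsi eta0) => //.
  move=> z h z01 hh h1 h2; have := fw z h z01 hh h1 h2.
  by rewrite ler_norml => /andP[].
have h2 : - f x - \sum_i m i * - f (y i) <= w + (\sum_i m i * Psi (y i) - Psi x).
  have cNf : C01 (fun u => - f u) by move=> z; apply: cvgN; exact: cf.
  apply: (one_sided_estimate x01 (ltW w0) m0 y01 m1 mx cNf cPsi eta0) => //.
  move=> z h z01 hh h2 h3; have := fw z h z01 hh h2 h3.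
  by rewrite ler_norml => /andP[_]; lra.
have h3 : \sum_i m i * - f (y i) = - \sum_i m i * f (y i).
  by rewrite -sumrN; apply: eq_bigr => i _; rewrite mulrN.
rewrite h3 in h2; rewrite cE ler_norml; apply/andP; split; lra.
Qed.

End MeanEstimate.

(** * k-monotonicity and moduli of smoothness *)

Section Monotonicity.
Variable R : realType.
Implicit Types (f : R -> R) (P : {poly R}).

Lemma derivn_comp_shift P (d : R) k :
  (P \Po ('X + d%:P))^`(k) = P^`(k) \Po ('X + d%:P).
Proof.
elim: k => [|k IH]; first by rewrite !derivn0.
by rewrite !derivnS IH deriv_comp derivD derivX derivC addr0 mulr1.
Qed.

(** One difference replaces P by P (X + d) - P, whose derivative of order k is nonnegative because
    that of P is nondecreasing. *)
Lemma iter_diff_horner_ge0 k P (a d : R) : 0 <= d ->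
  (forall x, a <= x <= a + k%:R * d -> 0 <= P^`(k).[x]) ->
  0 <= iter k (@diff_seq R) (fun i => P.[a + i%:R * d]) 0.
Proof.
move=> d0; elim: k P => [|k IH] P P0.
  by rewrite /=; apply: P0; rewrite mul0r addr0 lexx.
rewrite iterSr.
have -> : diff_seq (fun i => P.[a + i%:R * d]) =
    fun i => (P \Po ('X + d%:P) - P).[a + i%:R * d].
  apply/funext => i; rewrite /diff_seq hornerD hornerN horner_comp.
  rewrite hornerD hornerX hornerC -natr1; congr (P.[_] - _).
  by ring.
apply: IH => x /andP[ax xa].
rewrite derivnB derivn_comp_shift hornerD hornerN horner_comp hornerD hornerX hornerC.
rewrite subr_ge0; apply: horner_le; first by rewrite lerDl.
move=> y /andP[xy yx]; rewrite -derivnS; apply: P0.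
by rewrite (le_trans ax xy) (le_trans yx)//= -natr1 mulrDl mul1r addrA lerD2r.
Qed.

Lemma kmonotone_horner k P :
  (forall x, 0 <= x <= 1 -> 0 <= P^`(k).[x]) -> kmonotone k (horner P).
Proof.
move=> P0; split; first exact: (continuous_subspaceT (@continuous_horner _ P)).
move=> d x d0 x01; rewrite /sym_diff; case: ifP => // /andP[/andP[a0 a1] /andP[b0 b1]].
have := @iter_diff_horner_ge0 k P (x - k%:R * d / 2) d (ltW d0).
rewrite iter_diff_seqE.
under eq_bigr do rewrite add0n.
apply => y /andP[ay yb]; apply: P0; rewrite (le_trans a0 ay) (le_trans yb)//.
by apply: le_trans b1; lra.
Qed.

(** The forward difference at j is the symmetric difference of step 1 / L centred at (j + k / 2) /
    L. *)
Lemma kmonotone_samples k f (L : nat) j : (0 < L)%N -> kmonotone k f -> (j + k <= L)%N ->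
  0 <= iter k (@diff_seq R) (fun i => f (i%:R / L%:R)) j.
Proof.
move=> L0 [_ fk] jk; have L0' : 0 < L%:R :> R by rewrite ltr0n.
have Ln : L%:R != 0 :> R by rewrite gt_eqF.
pose x : R := (j%:R + k%:R / 2) / L%:R.
have xa : x - k%:R * L%:R^-1 / 2 = j%:R / L%:R by rewrite /x; field.
have xb : x + k%:R * L%:R^-1 / 2 = (j + k)%:R / L%:R by rewrite /x natrD; field.
have r01 i : (i <= L)%N -> 0 <= (i%:R / L%:R : R) <= 1.
  by move=> iL; rewrite divr_ge0// ler_pdivrMr// mul1r ler_nat.
have ra := r01 j (leq_trans (leq_addr k j) jk); have rb := r01 _ jk.
have x01 : 0 <= x <= 1.
  have := ra; have := rb; rewrite -xa -xb => /andP[? ?] /andP[? ?]; apply/andP; split; lra.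
have := fk L%:R^-1 x; rewrite invr_gt0 => /(_ L0' x01).
rewrite /sym_diff xa xb ra rb iter_diff_seqE; congr (0 <= _).
by apply: eq_bigr => i _; congr (_ * f _); rewrite natrD; field.
Qed.

End Monotonicity.

(** * Second moduli of smoothness *)

Section Modulus.
Variable R : realType.
Implicit Types (f psi : R -> R).

Lemma C01_bounded f : C01 f -> exists B, forall x, 0 <= x <= 1 -> `|f x| <= B.
Proof.
move=> cf; have [c _ fc] := EVT_max (@ler01 R) cf.
have cNf : C01 (fun u => - f u) by move=> z; apply: cvgN; exact: cf.
have [e _ fe] := EVT_max (@ler01 R) cNf.
exists (Num.max (f c) (- f e)) => x x01.
have xi : x \in `[0, 1] by rewrite in_itv.
by rewrite ler_norml lerNl le_max fe ?orbT//= le_max fc.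
Qed.

Lemma sym_diff2E f (h z : R) : 0 <= z - h <= 1 -> 0 <= z + h <= 1 ->
  sym_diff 2 h f z = f (z - h) + f (z + h) - 2 * f z.
Proof.
have e : 2%:R * h / 2 = h by field.
move=> h1 h2; rewrite /sym_diff e h1 h2 /= !big_ord_recl big_ord0 /= /bump /=.
have -> : z - h + 0%:R * h = z - h by ring.
have -> : z - h + (1 + 0)%:R * h = z by ring.
have -> : z - h + (1 + (1 + 0))%:R * h = z + h by ring.
by rewrite bin0 bin1 binn subn0 (_ : (2 - 1)%N = 1%N)// subnn expr2 expr1 expr0; ring.
Qed.

Section Bounded.
Variables (f psi : R -> R).
Hypothesis cf : C01 f.

(** The bound is uniform in the step, so both nested suprema of the modulus are taken over bounded
    sets; otherwise [sup] would be a default value. *)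
Lemma sym_diff2_bounded : exists B, 0 <= B /\ forall h z, `|sym_diff 2 h f z| <= B.
Proof.
have [B fB] := C01_bounded cf.
have B0 : 0 <= B by apply: le_trans (fB 0 _); rewrite ?normr_ge0// lexx ler01.
exists (4 * B); split; first by rewrite mulr_ge0.
move=> h z; case: (boolP ((0 <= z - h <= 1) && (0 <= z + h <= 1))) => [/andP[h1 h2]|hn].
  rewrite sym_diff2E//; have := fB _ h1; have := fB _ h2.
  have /fB : 0 <= z <= 1 by move: h1 h2 => /andP[? ?] /andP[? ?]; apply/andP; split; lra.
  by rewrite !ler_norml => /andP[? ?] /andP[? ?] /andP[? ?]; apply/andP; split; lra.
by rewrite /sym_diff (_ : 2%:R * h / 2 = h) ?(negbTE hn) ?normr0 ?mulr_ge0//; field.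
Qed.

Let S (t : R) := [set sup_norm (fun x => sym_diff 2 (h * psi x) f x) | h in `]0, t]%classic].

Lemma sup_norm_sym_diff2_le h z : 0 <= z <= 1 ->
  `|sym_diff 2 (h * psi z) f z| <= sup_norm (fun x => sym_diff 2 (h * psi x) f x).
Proof.
move=> z01; have [B [B0 fB]] := sym_diff2_bounded.
apply: ub_le_sup; last by exists z => //=; rewrite in_itv.
by exists B => _ [u _ <-].
Qed.

Lemma omega_set_ubound t : has_ubound (S t).
Proof.
have [B [B0 fB]] := sym_diff2_bounded.
exists B => _ [h _ <-]; apply: ge_sup => [|_ [u _ <-]//].
by exists `|sym_diff 2 (h * psi 0) f 0|, 0 => //=; rewrite in_itv/= lexx ler01.
Qed.

Lemma omega2_w_ge (t h z : R) : 0 < h <= t -> 0 <= z <= 1 ->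
  `|sym_diff 2 (h * psi z) f z| <= omega2_w psi f t.
Proof.
move=> ht z01; apply: (le_trans (sup_norm_sym_diff2_le _ z01)).
apply: ub_le_sup; first exact: omega_set_ubound.
by exists h => //=; rewrite in_itv.
Qed.

Lemma omega2_w_le0 t : t <= 0 -> omega2_w psi f t = 0.
Proof.
move=> t0; rewrite /omega2_w (_ : [set _ | _ in _] = set0) ?sup0//.
rewrite -subset0 => _ [h /= + _]; rewrite in_itv/= => /andP[h0 ht].
by have := lt_le_trans h0 (le_trans ht t0); rewrite ltxx.
Qed.

Lemma omega2_w_ge0 t : 0 <= omega2_w psi f t.
Proof.
case: (ltP 0 t) => t0; last by rewrite omega2_w_le0.
by apply: le_trans (normr_ge0 _) (@omega2_w_ge t t 0 _ _); rewrite ?t0 lexx ?ler01.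
Qed.

Lemma omega2_w_le t1 t2 : t1 <= t2 -> omega2_w psi f t1 <= omega2_w psi f t2.
Proof.
move=> t12; case: (ltP 0 t1) => t0; last by rewrite (omega2_w_le0 t0) omega2_w_ge0.
apply: ge_sup.
  by exists (sup_norm (fun x => sym_diff 2 (t1 * psi x) f x)), t1 => //=; rewrite in_itv/= t0 lexx.
move=> _ [h /= + <-]; rewrite in_itv/= => /andP[h0 ht].
apply: ub_le_sup; first exact: omega_set_ubound.
by exists h => //=; rewrite in_itv/= h0 (le_trans ht).
Qed.

End Bounded.
End Modulus.

(** * The operator M_n *)

Section Operator.
Variable R : realType.
Implicit Types (f g : R -> R).

(** Bernstein degree n^2 adds a variance of at most x (1 - x) / n^2, the order already present in
    the mixture; the degree of the result is governed by [H] alone. *)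
Definition sampled_durr_mix (H : {poly R}) (n : nat) f : {poly R} :=
  durr_mix H (bsum (n ^ 2) (fun j => f (j%:R / (n ^ 2)%:R))).

Variables (q n : nat) (H : {poly R}).
Hypotheses (n_gt0 : (0 < n)%N) (H_0 : H`_0 = 0)
  (H_1 : H.[1] = 1)
  (H_ge0 : forall r x, (r <= q.+2)%N -> 0 <= x <= 1 -> 0 <= H^`(r).[x])
  (H_int : int01 H <= mix_const R q / n%:R ^+ 2).
Local Notation M := (sampled_durr_mix H n).
Let L := (n ^ 2)%N.
Let L_gt0 : (0 < L)%N. Proof. by rewrite expn_gt0 n_gt0. Qed.
Let Ln0 : L%:R != 0 :> R. Proof. by rewrite pnatr_eq0 -lt0n. Qed.

Let sample_itv (j : nat) : (j <= L)%N -> 0 <= (j%:R / L%:R : R) <= 1.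
Proof.
by move=> jL; rewrite divr_ge0 ?ler0n//= ler_pdivrMr ?ltr0n// mul1r ler_nat.
Qed.

Lemma sampled_durr_mix_linear : linear_operator M.
Proof.
split=> [f g cf cg fg|a f g cf cg]; last first.
  by rewrite /sampled_durr_mix bsumP linearP.
by rewrite /sampled_durr_mix; congr durr_mix; apply: eq_bsum => j jL; apply/fg/sample_itv.
Qed.

Let durr_mix_derivn_ge0 k p : (k <= q.+2)%N ->
  (forall x, 0 <= x <= 1 -> 0 <= p^`(k).[x]) ->
  forall x, 0 <= x <= 1 -> 0 <= (durr_mix H p)^`(k).[x].
Proof.
case: k => [|k] kq p0 x x01; last by apply: derivn_durr_mix_ge0 => // u; exact: H_ge0.
apply: durr_mix_ge0 => //; first exact: (fun u => @H_ge0 0%N u (leq0n _)).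
by move=> u; exact: H_ge0.
Qed.

Lemma sampled_durr_mix_positive : positive_operator M.
Proof.
move=> f cf f0 x x01; apply: (@durr_mix_derivn_ge0 0 _ (leq0n _) _ x x01).
by move=> u u01; apply: bsum_ge0 => // j jL; exact/f0/sample_itv.
Qed.

Lemma sampled_durr_mix_into_Pi : (size H <= n.+1)%N -> into_Pi n M.
Proof. by move=> sizeH f cf; apply: leq_trans sizeH; exact: size_durr_mix. Qed.

Lemma sampled_durr_mix_kmonotone k : (k <= q)%N -> preserves_kmonotonicity k M.
Proof.
move=> kq f fk; apply: kmonotone_horner; apply: durr_mix_derivn_ge0.
  by rewrite (leq_trans kq)// -addn2 leq_addr.
by move=> x x01; apply: derivn_bsum_ge0 => // j jk; apply: kmonotone_samples.
Qed.

Section Weights.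
Variables (x : R).
Hypothesis x01 : 0 <= x <= 1.
(** For fixed x the operator is a finite mean of the samples with these weights, so Jensen's
    inequality is needed for finite sums only. *)
Let m (i : 'I_L.+1) : R := (durr_mix H (bern R L i)).[x].
Let y (i : 'I_L.+1) : R := i%:R / L%:R.

Let sum_weights (c : nat -> R) : (durr_mix H (bsum L c)).[x] = \sum_i m i * c i.
Proof.
rewrite /bsum linear_sum horner_sum; apply: eq_bigr => i _.
by rewrite linearZ hornerZ mulrC.
Qed.

Let m_ge0 i : 0 <= m i.
Proof.
apply: (@durr_mix_derivn_ge0 0 (bern R L i) (leq0n _) _ x x01).
by move=> u u01; exact: bern_ge0.
Qed.

Let y01 i : 0 <= y i <= 1.
Proof. by apply: sample_itv; rewrite -ltnS. Qed.

Let m_sum : \sum_i m i = 1.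
Proof.
rewrite (eq_bigr (fun i => m i * (fun=> 1) (i : nat))); last by move=> i _; rewrite mulr1.
by rewrite -(sum_weights (fun=> 1)) bsum_const durr_mix_const// H_1 scale1r hornerC.
Qed.

Let m_mean : \sum_i m i * y i = x.
Proof.
rewrite -(sum_weights (fun j => j%:R / L%:R)).
rewrite (@eq_bsum _ _ _ (fun j => L%:R^-1 * j%:R + (fun=> 0) j)); last first.
  by move=> j _; rewrite addr0 mulrC.
rewrite bsumP bsum_const addr0 bsum_id scalerA mulVf// scale1r.
by rewrite durr_mix_id// H_1 scale1r hornerX.
Qed.

Let m_var : \sum_i m i * (y i - x) ^+ 2 <=
  (2 * mix_const R q + 1) * (n%:R^-1 * phi x) ^+ 2.
Proof.
have sq : \sum_i m i * y i ^+ 2 =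
    (1 - L%:R^-1) * (x ^+ 2 + 2 * int01 H * (x - x ^+ 2)) + L%:R^-1 * x.
  rewrite -(sum_weights (fun j => (j%:R / L%:R) ^+ 2)).
  rewrite (@eq_bsum _ _ _ (fun j => L%:R ^- 2 * (j%:R * (j%:R - 1)) +
    (L%:R ^- 2 * j%:R + (fun=> 0) j))); last by move=> j _; rewrite addr0; field.
  rewrite !bsumP bsum_const addr0 bsum_id bsum_sq !scalerA [in LHS]linearD ![in LHS]linearZ /=.
  rewrite durr_mix_id// durr_mix_sq// H_1 !scale1r !(hornerD, hornerZ, hornerN, hornerX, hornerXn).
  by field.
rewrite (eq_bigr (fun i => m i * y i ^+ 2 - 2 * x * (m i * y i) + x ^+ 2 * m i)); last first.
  by move=> i _; ring.
rewrite big_split sumrB/= -!mulr_sumr sq m_mean m_sum exprMn phi_sq//.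
have LE : L%:R^-1 = n%:R^-1 ^+ 2 :> R by rewrite /L natrX exprVn.
set u := n%:R^-1 ^+ 2 in LE *; rewrite LE.
have u0 : 0 <= u by exact: sqr_ge0.
have I0 : 0 <= int01 H.
  by apply: int01_ge0; exact: (fun u => @H_ge0 0%N u (leq0n _)).
have I1 : int01 H <= mix_const R q * u by move: H_int; rewrite /u exprVn.
have x01' := x01; have X0 : 0 <= x * (1 - x).
  by move: x01' => /andP[? ?]; rewrite mulr_ge0// subr_ge0.
have -> : (1 - u) * (x ^+ 2 + 2 * int01 H * (x - x ^+ 2)) + u * x - 2 * x * x + x ^+ 2 * 1 =
  (2 * int01 H + u) * (x * (1 - x)) - 2 * (u * int01 H * (x * (1 - x))) by ring.
have h1 : 0 <= u * int01 H * (x * (1 - x)) by apply: mulr_ge0 => //; exact: mulr_ge0.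
have h2 : (2 * int01 H + u) * (x * (1 - x)) <= (2 * mix_const R q + 1) * u * (x * (1 - x)).
  by rewrite ler_wpM2r//; lra.
lra.
Qed.

Lemma sampled_durr_mix_estimate f (l l1 : R) : C01 f -> 0 <= l <= l1 -> l1 < 2 ->
  `|f x - (M f).[x]| <= estimate_const (2 * mix_const R q + 1) l1 *
    omega2_w (fun y => phi y `^ l) f (local_step n%:R^-1 l x).
Proof.
move=> cf ll l12; set w := omega2_w _ _ _; set C := 2 * mix_const R q + 1.
have C1 : 1 <= C by have := mix_const_ge0 R q; rewrite /C; lra.
have w0 : 0 <= w by exact: omega2_w_ge0.
have c0 : 0 < estimate_const C l1 by apply: estimate_const_gt0 => //; lra.
have -> : (M f).[x] = \sum_i m i * f (y i) by exact: (sum_weights (fun j => f (j%:R / L%:R))).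
(* At an end point the variance is 0, so all nodes of nonzero weight equal x and the operator
   interpolates. *)
case: (boolP (0 < x < 1)) => [xo|xb]; last first.
  have px : phi x = 0.
    have xE : x = 0 \/ x = 1.
      move: x01 xb => /andP[]; rewrite !le_eqVlt => /predU1P[<-|->]; first by left.
      by move=> /predU1P[->|->]//; right.
    by rewrite /phi; case: xE => ->; rewrite ?mul0r ?subrr ?mulr0 sqrtr0.
  have v0 i : m i * (y i - x) ^+ 2 = 0.
    have : \sum_i m i * (y i - x) ^+ 2 == 0.
      rewrite eq_le; apply/andP; split; last by apply: sumr_ge0 => j _; rewrite mulr_ge0 ?sqr_ge0.
      by apply: le_trans m_var _; rewrite px mulr0 expr0n mulr0.
    rewrite psumr_eq0 => [/allP/(_ i)|j _]; last by rewrite mulr_ge0 ?sqr_ge0.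
    by rewrite mem_index_enum => /(_ isT)/eqP.
  have -> : \sum_i m i * f (y i) = f x.
    rewrite -[RHS]mul1r -m_sum mulr_suml; apply: eq_bigr => i _.
    have /eqP := v0 i; rewrite mulf_eq0 sqrf_eq0 subr_eq0 => /orP[/eqP->|/eqP->//].
    by rewrite !mul0r.
  by rewrite subrr normr0 mulr_ge0// ltW.
(* The modulus may be 0 while [mean_estimate] needs w > 0, so w is increased by an arbitrarily small
   amount. *)
apply/ler_addgt0Pr => e e0.
pose e' := e / estimate_const C l1.
have e'0 : 0 < e' by rewrite divr_gt0.
have -> : estimate_const C l1 * w + e = estimate_const C l1 * (w + e').
  by rewrite mulrDr; congr (_ + _); rewrite mulrC divfK// gt_eqF.
have nV0 : 0 < n%:R^-1 :> R by rewrite invr_gt0 ltr0n.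
apply: (mean_estimate xo nV0 ll l12 C1 _ m_ge0 y01 m_sum m_mean m_var cf).
  by rewrite ltr_wpDl.
move=> z h z01 /andP[h0 hh] h1 h2; have pz := phi_gt0 z01.
have pl := powR_gt0 l pz.
(* Exhibits h as an admissible weighted step of the modulus. *)
have hE : h = h / phi z `^ l * phi z `^ l by rewrite divfK// gt_eqF.
have ht : 0 < h / phi z `^ l <= local_step n%:R^-1 l x.
  by rewrite divr_gt0//= ler_pdivrMr.
have z01' : 0 <= z <= 1 by move: z01 => /andP[? ?]; rewrite !ltW.
have := @omega2_w_ge _ f (fun y => phi y `^ l) cf _ _ _ ht z01'.
rewrite -hE sym_diff2E; [|apply/andP; split; lra|apply/andP; split; lra].
by move/le_trans; apply; rewrite -/w; lra.
Qed.

End Weights.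
End Operator.

Theorem corollary1p3 (R : realType) (q : nat) :
  exists c : R -> R,
  forall n : nat, (0 < n)%N ->
  exists M : (R -> R) -> {poly R},
    [/\ linear_operator M, positive_operator M, into_Pi n M &
        forall k : nat, (k <= q)%N -> preserves_kmonotonicity k M] /\
    [/\ forall lambda1 lambda : R, lambda1 < 2 -> 0 <= lambda <= lambda1 ->
        forall f : R -> R, C01 f -> forall x : R, 0 <= x <= 1 ->
          `|f x - (M f).[x]| <=
          c lambda1 *
          omega2_w (fun y => phi y `^ lambda) f
            (n%:R^-1 * phi x `^ (1 - lambda / 2) *
             (phi x + n%:R^-1) `^ (- (lambda / 2))),
        forall f : R -> R, C01 f -> forall x : R, 0 <= x <= 1 ->
          `|f x - (M f).[x]| <= c 0 * omega2 f (Num.sqrt (x * (1 - x)) / n%:R) &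
        forall f : R -> R, C01 f -> forall x : R, 0 <= x <= 1 ->
          `|f x - (M f).[x]| <=
            c 1 * omega2_w (@phi R) f
                    (n%:R^-1 * Num.sqrt (phi x / (phi x + n%:R^-1))) <=
            c 1 * omega2_w (@phi R) f n%:R^-1].
Proof.
pose c := estimate_const (2 * mix_const R q + 1).
have mc0 := mix_const_ge0 R q.
exists c => n n0.
have [H [sH H0 H1 Hge HI]] := mix_poly_exists R q n0.
exists (sampled_durr_mix H n).
have est := sampled_durr_mix_estimate n0 H0 H1 Hge HI.
have nV0 : 0 < n%:R^-1 :> R by rewrite invr_gt0 ltr0n.
split; split.
- exact: sampled_durr_mix_linear.
- exact: (sampled_durr_mix_positive n0 H0 Hge).
- exact: sampled_durr_mix_into_Pi.
- by move=> k kq; exact: (sampled_durr_mix_kmonotone n0 H0 Hge).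
- by move=> l1 l l12 ll f cf x x01; exact: est.
- move=> f cf x x01; have l00 : 0 <= (0 : R) <= 0 by rewrite lexx.
  have := est x x01 f 0 0 cf l00 (ltr0n _ _).
  rewrite /local_step mul0r subr0 oppr0 powRr0 mulr1 powRr1 ?sqrtr_ge0// [n%:R^-1 * _]mulrC.
  (* With [powR], 0 to the power 0 is 1, so the weight is 1 also where [phi] vanishes. *)
  rewrite (_ : (fun y => phi y `^ 0) = fun=> 1)//.
  by apply/funext => y; rewrite powRr0.
move=> f cf x x01; have l11 : 0 <= (1 : R) <= 1 by rewrite ler01 lexx.
have p0 : 0 <= phi x by exact: sqrtr_ge0.
have pd0 : 0 < phi x + n%:R^-1 by rewrite ltr_wpDl.
apply/andP; split.
  have := est x x01 f 1 1 cf l11 (ltr_nat _ 1 2).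
  rewrite /local_step (_ : 1 - 1 / 2 = 2^-1 :> R); last by field.
  rewrite div1r powRN !powR12_sqrt ?(ltW pd0)// -mulrA -sqrtrV ?(ltW pd0)// -sqrtrM//.
  rewrite (_ : (fun y => phi y `^ 1) = @phi R)//.
  by apply/funext => y; rewrite powRr1 ?sqrtr_ge0.
rewrite ler_wpM2l//.
  by apply/ltW/estimate_const_gt0; lra.
apply: omega2_w_le => //; rewrite ler_piMr ?(ltW nV0)//.
by rewrite -[leRHS]sqrtr1 ler_wsqrtr// ler_pdivrMr// mul1r lerDl ltW.
Qed.
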